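(* For positive integers $j\le r$ and $\Re(s)>1$, \[ \psi(\{1\}_{j-1},2,\{1\}_{r-j};s)=\sum_{i=0}^{r-j}(-1)^i\binom{i+j}{i}\binom{s+r-i-j-1}{r-i-j}T(i+j+1)T(s+r-i-j)+(-1)^{r-j-1}\sum_{l=r-j}^{r}\binom{l}{r-j}\binom{s+r-l-1}{r-l}T(l+1,s+r-l). \]
   Context: For an index $(k_1,\ldots,k_r)$ and $z\in[-1,1)$, ${\rm A}(k_1,\ldots,k_r;z)=2^r\sum_{1\le n_1<\cdots<n_r,\ n_i\equiv i \pmod 2}\frac{z^{n_r}}{n_1^{k_1}\cdots n_r^{k_r}}$. $\psi(k_1,\ldots,k_r;s)=\frac{1}{\Gamma(s)}\int_0^\infty t^{s-1}\frac{{\rm A}(k_1,\ldots,k_r;\tanh(t/2))}{\sinh t}\,dt$. Multiple $T$-function: $T(k_1,\ldots,k_{r-1},s)=2^r\sum_{0<m_1<\cdots<m_r,\ m_i\equiv i\pmod 2}\frac{1}{m_1^{k_1}\cdots m_{r-1}^{k_{r-1}}m_r^s}$ (so $T(s)=2\sum_{m \text{ odd}}m^{-s}$). $\{1\}_j$ denotes $j$ repetitions of $1$; $\binom{s+n-1}{n}=s(s+1)\cdots(s+n-1)/n!$. *)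

(* Defs.v *)
From HB Require Import structures.
From mathcomp Require Import all_boot all_order all_algebra.
From mathcomp Require Import complex.
From mathcomp Require Import all_classical all_reals all_analysis.

Set Implicit Arguments.
Unset Strict Implicit.
Unset Printing Implicit Defensive.

Import Order.TTheory GRing.Theory Num.Theory.
Import numFieldNormedType.Exports.

Local Open Scope classical_set_scope.
Local Open Scope complex_scope.
Local Open Scope ring_scope.

Section Defs.
Variable R : realType.
Local Notation C := (R[i]).

Definition sinh (t : R) : R := (expR t - expR (- t)) / 2.
Definition cosh (t : R) : R := (expR t + expR (- t)) / 2.
Definition tanh (t : R) : R := sinh t / cosh t.

(* The principal value of t ^ s; only meaningful for t > 0. *)
Definition cpow (t : R) (s : C) : C :=
  (expR (complex.Re s * ln t))%:C *
  (cos (complex.Im s * ln t) +i* sin (complex.Im s * ln t)).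

Definition integral0y (f : R -> C) : C :=
  Rintegral lebesgue_measure `]0, +oo[ (fun t => complex.Re (f t)) +i*
  Rintegral lebesgue_measure `]0, +oo[ (fun t => complex.Im (f t)).

Definition Gamma (s : C) : C :=
  integral0y (fun t => cpow t (s - 1) * (expR (- t))%:C).

(* 1 <= n_1 < ... < n_r and n_i = i mod 2; positions are 0-based, so that the
   tuple entry of rank i is n_(i+1). *)
Definition admissible (r N : nat) (n : r.-tuple 'I_N) : bool :=
  [&& [forall i, 0 < tnth n i]%N,
      sorted ltn (map val n) &
      [forall i : 'I_r, tnth n i == i.+1 %[mod 2]]].

(* The infinite sums below are limits of the sums over n_1 < ... < n_r < N. *)
Definition A (k : seq nat) (z : R) : R :=
  2 ^+ size k *
  limn (fun N : nat =>
    \sum_(n : (size k).-tuple 'I_N | admissible n)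
      z ^+ last 0%N (map val n) /
      \prod_(i < size k) (tnth n i)%:R ^+ nth 0%N k i).

Definition psi (k : seq nat) (s : C) : C :=
  (Gamma s)^-1 *
  integral0y (fun t => cpow t (s - 1) * (A k (tanh (t / 2)) / sinh t)%:C).

(* T k s is T(k_1, ..., k_(r-1), s) with r = size k + 1. The regular module
   C^o carries the usual topology of the complex numbers. *)
Definition T (k : seq nat) (s : C) : C :=
  2 ^+ (size k).+1 *
  (limn (fun N : nat =>
    \sum_(m : (size k).+1.-tuple 'I_N | admissible m)
      ((\prod_(i < size k) (tnth m (widen_ord (leqnSn _) i))%:R ^+ nth 0%N k i) *
       cpow (tnth m ord_max)%:R s)^-1 : C^o) : C).

(* risbin s n is the binomial coefficient (s + n - 1 choose n). *)
Definition risbin (s : C) (n : nat) : C :=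
  (\prod_(i < n) (s + i%:R)) / n`!%:R.

End Defs.

(* Main.v *)
(* Write [F_k(t) = A(k; tanh(t/2))]. Then [F_(k,1)' = F_k] and
   [F_(k,p+1)' = F_(k,p) / sinh] for [p >= 1], so [F_({1}_r) = t^r / r!]. With
   [U_l(t) = 2 sum_(n odd) e^(-nt) / n^(l+1)], which satisfies [U_l' = - U_(l-1)] and
   [U_(-1) = 1 / sinh], one checks by differentiation and by comparing the limits at
   [0+] that, for [m = r - j],
     [F_({1}_(j-1),2,{1}_m)(t) =
        sum_(i <= m) (-1)^i C(i+j,i) T(i+j+1) t^(m-i) / (m-i)!
        + (-1)^(m+1) sum_(a <= j) C(a+m,m) U_(a+m)(t) t^(j-a) / (j-a)!].
   Dividing by [sinh t] and taking Mellin transforms termwise gives the theorem, since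
   [U_l / sinh] expands in powers of [e^(-t)] with the coefficients of [T(l+1, .)].
   Because [psi] is defined with the factor [1 / Gamma(s)], one also needs
   [Gamma(s) <> 0]: by the functional equation it suffices to treat large [Re s], where
   the integrand concentrates near [t = Re s] and its phase is almost constant. *)
Require Import Defs.
From mathcomp Require Import all_boot all_order all_algebra.
From mathcomp Require Import complex ring lra.
From mathcomp Require Import all_classical all_reals all_analysis.
From mathcomp Require Import measurable_realfun.
Set Implicit Arguments.
Unset Strict Implicit.
Unset Printing Implicit Defensive.
Import Order.TTheory GRing.Theory Num.Theory.
Import numFieldNormedType.Exports.

(** * Nested sums over admissible tuples *)

(** One family of power series carries the proof: [zeta_series k z], with [k] read from the
    outermost summation variable inwards. At [z = tanh (t / 2)] it gives [A], at [z = e^(-t)] the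
    functions [U_l]. An outermost exponent [0] produces the factor [2 z / (1 - z^2)], which is
    [sinh t] in the first case and [1 / sinh t] in the second; this explains the differentiation
    rules, and why [U_l / sinh] stays in the family. The delicate term is [U_0], with its
    logarithmic singularity at [0]. It occurs only for [a = m = 0], multiplied by [t^j] with
    [j >= 1]. This power kills it in the limit at [0+], and lifts the real part of the Mellin
    argument above [2], where the crude bound [U_0 <= 1 / sinh t <= 1 / t] suffices. The condition
    [Re s > 1] makes [t^(s-1) / sinh t] integrable. Complex integrals are handled through the real
    kernels [t^a cos (b ln t)] and [t^a sin (b ln t)]. Convergence of the sums in [T] at complex
    arguments comes out of the termwise transform, after division by [Gamma s]. *)

Section AdmissibleTuples.
Local Open Scope ring_scope.

(** Peels off the largest summation variable. Positivity of [x] on the left comes from [x] exceeding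
    an earlier entry or, for [r = 0], from [x] being odd. *)
Lemma admissible_rcons r N (m : r.-tuple 'I_N) (x : 'I_N) :
  admissible [tuple of rcons m x] =
  [&& admissible m, all (fun y : 'I_N => (y < x)%N) m & x == r.+1 %[mod 2]].
Proof.
have tn (i : 'I_r.+1) : tnth [tuple of rcons m x] i =
    if unlift ord_max i is Some i' then tnth m i' else x.
  rewrite (tnth_nth x) /= nth_rcons size_tuple.
  case: unliftP => [i'|] ->.
    by rewrite lift_max ltn_ord (tnth_nth x).
  by rewrite ltnn eqxx.
have lastE : tnth [tuple of rcons m x] ord_max = x by rewrite tn unlift_none.
have liftE i : tnth [tuple of rcons m x] (lift ord_max i) = tnth m i.
  by rewrite tn liftK.
have srt : sorted ltn (map val [tuple of rcons m x]) =
    all (fun y : 'I_N => (y < x)%N) m && sorted ltn (map val m).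
  by rewrite /= map_rcons !(sorted_pairwise ltn_trans) pairwise_rcons all_map.
rewrite /admissible srt.
apply/and3P/and3P => [[/forallP p /andP[lt s] /forallP q]|].
  split=> //; last by have := q ord_max; rewrite lastE.
  apply/and3P; split=> //; apply/forallP => i.
    by have := p (lift ord_max i); rewrite liftE.
  by have := q (lift ord_max i); rewrite liftE lift_max.
case=> /and3P[/forallP p s /forallP q] lt px.
have pos : (0 < x)%N.
  case: r m lt p px {tn lastE liftE srt s q} => [|r] m lt p px.
    by case: (nat_of_ord x) px.
  by have /allP/(_ _ (mem_tnth ord0 m)) := lt; apply: leq_ltn_trans.
split; last 2 first.
- exact/andP.
- apply/forallP => i; rewrite tn; case: unliftP => [i'|] ->.
    by rewrite lift_max.
  exact: px.
by apply/forallP => i; rewrite tn; case: unliftP.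
Qed.

Section NestedSums.
Variables (K : comNzRingType) (h : nat -> nat -> K).

Fixpoint nested_sum r N : K :=
  if r is r'.+1 then
    \sum_(q < N | q == r'.+1 %[mod 2]) h r' q * nested_sum r' q
  else 1.

(** The bound [q] is separate from the type ['I_N]: the induction replaces it by the value of the
    outer variable, while the inner tuples keep their type. *)
Lemma admissible_sum_lt r N q : (q <= N)%N ->
  \sum_(m : r.-tuple 'I_N | admissible m && all (fun y : 'I_N => (y < q)%N) m)
    \prod_(i < r) h i (tnth m i) = nested_sum r q.
Proof.
elim: r q => [|r IH] q qN.
  rewrite (big_pred1 [tuple]) => [|m]; first by rewrite big_ord0.
  rewrite (tuple0 m) /=; apply/andP; split=> //; apply/and3P; split=> //.
    by apply/forallP => -[].
  by apply/forallP => -[].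
(* [c] appends the largest entry and [d] splits it off; this bijection turns the sum over tuples
   into a double sum. *)
pose c (p : 'I_N * r.-tuple 'I_N) := [tuple of rcons p.2 p.1].
pose d (t : r.+1.-tuple 'I_N) :=
  (tnth t ord_max, [tuple tnth t (widen_ord (leqnSn r) i) | i < r]).
have cw x (m : r.-tuple 'I_N) i :
    tnth (c (x, m)) (widen_ord (leqnSn r) i) = tnth m i.
  by rewrite !(tnth_nth x) /= nth_rcons size_tuple ltn_ord.
have cm x (m : r.-tuple 'I_N) : tnth (c (x, m)) ord_max = x.
  by rewrite (tnth_nth x) /= nth_rcons size_tuple ltnn eqxx.
have cd : bijective c.
  exists d => [[x m]|t]; rewrite /d.
    rewrite cm; congr pair; apply: eq_from_tnth => i; by rewrite tnth_mktuple cw.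
  apply: eq_from_tnth => i; case: (unliftP ord_max i) => [i'|] ->.
    have -> : lift ord_max i' = widen_ord (leqnSn r) i'.
      by apply: val_inj; rewrite /= /bump leqNgt ltn_ord.
    by rewrite cw tnth_mktuple.
  by rewrite cm.
rewrite (reindex c) /=; last exact: onW_bij.
under eq_bigl => p.
  rewrite admissible_rcons all_rcons.
  over.
rewrite (eq_bigr (fun p : 'I_N * r.-tuple 'I_N =>
  h r p.1 * \prod_(i < r) h i (tnth p.2 i))); last first.
  move=> [x m] _; rewrite big_ord_recr /= cm mulrC; congr (_ * _).
  by apply: eq_bigr => i _; rewrite cw.
rewrite (big_ord_widen_cond N (fun x => x == r.+1 %[mod 2])
  (fun x => h r x * nested_sum r x)) //.
rewrite (eq_bigl (fun p : 'I_N * r.-tuple 'I_N =>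
   ((p.1 == r.+1 %[mod 2]) && (p.1 < q)%N) &&
   (admissible p.2 && all (fun y : 'I_N => (y < p.1)%N) p.2))); last first.
  move=> [x m] /=; apply/idP/idP.
    by move=> /andP[/and3P[-> ->] -> /andP[-> _]].
  move=> /andP[/andP[-> xq] /andP[-> mx]]; rewrite mx xq /=.
  by apply/allP => y /(allP mx) yx; exact: ltn_trans yx xq.
rewrite -(pair_big_dep (fun x : 'I_N => (x == r.+1 %[mod 2]) && (x < q)%N)
  (fun (x : 'I_N) (m : r.-tuple 'I_N) => admissible m && all (fun y : 'I_N => (y < x)%N) m)
  (fun x m => h r x * \prod_(i < r) h i (tnth m i))) /=.
apply: eq_bigr => x _; rewrite -big_distrr /= IH //.
exact: ltnW.
Qed.

Lemma admissible_sum r N :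
  \sum_(m : r.-tuple 'I_N | admissible m) \prod_(i < r) h i (tnth m i) =
  nested_sum r N.
Proof.
rewrite -(admissible_sum_lt r (leqnn N)); apply: eq_bigl => m.
by rewrite (_ : all _ m = true) ?andbT //; apply/allP => y _ /=.
Qed.

End NestedSums.

End AdmissibleTuples.

(** * Power series with nested coefficients *)

Section PowerSeries.
Local Open Scope classical_set_scope.
Local Open Scope ring_scope.
Variable R : realType.
Implicit Types (c : R^nat) (k : seq nat) (z q : R).

(** Such a power series converges on the open unit disc. The growth condition passes directly to
    derivatives and to partial sums of coefficients, so it can follow the recursion of
    [zeta_coef]. *)
Definition subexponential c :=
  forall q, 0 < q < 1 -> exists M, forall n, `|c n| * q ^+ n <= M.

Lemma succn_mul_expr_le q n : 0 < q < 1 -> n.+1%:R * q ^+ n * (1 - q) <= 1.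
Proof.
move=> /andP[q0 q1].
(* This is [(n + 1) q^n <= 1 + q + ... + q^n] multiplied by [1 - q], a form fit for induction. *)
suff : n.+1%:R * q ^+ n * (1 - q) + q ^+ n.+1 <= 1.
  by apply: le_trans; rewrite lerDl exprn_ge0 // ltW.
elim: n => [|n IH]; first by rewrite expr0 expr1; lra.
have q_ge0 := ltW q0.
have e1 : q ^+ n.+1 <= 1 by rewrite exprn_ile1 // ltW.
have e0 : 0 <= q ^+ n.+1 by rewrite exprn_ge0.
move: IH; rewrite [q ^+ n.+2]exprS -[n.+2]addn1 natrD mulrDl.
set E := q ^+ n.+1 in e1 e0 *.
have -> : n.+1%:R * E = q * (n.+1%:R * q ^+ n) by rewrite /E exprS; ring.
set X := n.+1%:R * q ^+ n => IH.
by nra.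
Qed.

(** In [q^n = p^n p^n] one factor bounds the coefficients and the other absorbs the factor of order
    [n] that differentiation or summation introduces. *)
Lemma subexponential_halve c q : subexponential c -> 0 < q < 1 ->
  exists p M, [/\ 0 < p < 1, q = p * p, 0 <= M &
    (forall n, `|c n| * p ^+ n <= M)].
Proof.
move=> ct /andP[q0 q1].
have p0 : 0 < Num.sqrt q by rewrite sqrtr_gt0.
have pp : Num.sqrt q * Num.sqrt q = q by rewrite -expr2 sqr_sqrtr // ltW.
have p01 : 0 < Num.sqrt q < 1.
  by rewrite p0 /= -sqrtr1 ltr_sqrt.
have [M HM] := ct _ p01.
exists (Num.sqrt q), M; split=> //.
by apply: le_trans (HM 0%N); rewrite expr0 mulr1.
Qed.

Lemma subexponential_diffs c : subexponential c -> subexponential (pseries_diffs c).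
Proof.
move=> ct q q01; have [p [M [p01 -> M0 HM]]] := subexponential_halve ct q01.
have /andP[p0 p1] := p01.
exists ((1 - p)^-1 * (M / p)) => n.
rewrite /pseries_diffs normrM exprMn.
have -> : `|n.+1%:R| * `|c n.+1| * (p ^+ n * p ^+ n) =
   (n.+1%:R * p ^+ n) * (`|c n.+1| * p ^+ n.+1 / p).
  by rewrite normr_nat exprS; field; rewrite gt_eqF.
apply: ler_pM.
- by rewrite mulr_ge0 // exprn_ge0 // ltW.
- by rewrite !mulr_ge0 ?invr_ge0 ?exprn_ge0 // ltW.
- by rewrite -div1r ler_pdivlMr ?subr_gt0 // succn_mul_expr_le.
- by rewrite ler_pM2r ?invr_gt0 //; exact: HM.
Qed.

Lemma subexponential_sum c :
  subexponential c -> subexponential (fun n => \sum_(m < n) c m).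
Proof.
move=> ct q q01; have [p [M [p01 -> M0 HM]]] := subexponential_halve ct q01.
have /andP[p0 p1] := p01.
exists (M * (1 - p)^-1) => n.
rewrite exprMn mulrA.
have pn0 m : 0 <= p ^+ m by rewrite exprn_ge0 // ltW.
apply: (@le_trans _ _ (M * (n%:R * p ^+ n))).
  rewrite mulrA; apply: ler_wpM2r => //.
  apply: le_trans (ler_wpM2r (pn0 n) (ler_norm_sum _ _ _)) _.
  rewrite mulr_suml mulr_natr -[X in M *+ X]card_ord -sumr_const.
  apply: ler_sum => m _; apply: le_trans (HM m).
  apply: ler_wpM2l => //; apply: ler_wiXn2l; [exact: ltW|exact: ltW|].
  exact: ltnW.
apply: ler_wpM2l => //.
rewrite -div1r ler_pdivlMr ?subr_gt0 //.
apply: le_trans (succn_mul_expr_le n p01).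
by apply: ler_wpM2r; [rewrite subr_ge0 ltW|apply: ler_wpM2r => //; rewrite ler_nat].
Qed.

Lemma subexponential_mul_bounded c d C :
  subexponential c -> (forall n, `|d n| <= C) -> subexponential (fun n => d n * c n).
Proof.
move=> ct dC q q01; have [M HM] := ct q q01; exists (C * M) => n.
rewrite normrM -mulrA ler_pM // mulr_ge0 // exprn_ge0 // ltW //.
by case/andP: q01.
Qed.

(** Comparison with a geometric series of ratio [|z| / q], for [q] halfway between [|z|] and [1]. *)
Lemma subexponential_cvg c z : subexponential c -> `|z| < 1 -> cvgn (pseries c z).
Proof.
move=> ct z1.
pose q := (`|z| + 1) / 2.
have z0 := normr_ge0 z.
have q01 : 0 < q < 1 by rewrite /q; apply/andP; split; lra.
have zq : `|z| < q by rewrite /q; lra.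
have [M HM] := ct q q01; have /andP[q0 q1] := q01.
apply: normed_cvg.
apply: (@series_le_cvg _ _ (geometric M (`|z| / q))) => [n|n|n|].
- by rewrite /=.
- rewrite /geometric /= mulr_ge0 ?exprn_ge0 ?divr_ge0 ?(ltW q0) //.
  by apply: le_trans (HM 0%N); rewrite expr0 mulr1.
- rewrite /geometric /= normrM normrX expr_div_n.
  rewrite -[leLHS](mulfK (_ : q ^+ n != 0)) ?expf_neq0 ?gt_eqF //.
  rewrite mulrA ler_pM2r ?invr_gt0 ?exprn_gt0 //.
  by rewrite mulrAC; apply: ler_wpM2r; rewrite ?exprn_ge0.
- apply: is_cvg_geometric_series.
  by rewrite normrM normr_id normfV (gtr0_norm q0) // ltr_pdivrMr // mul1r.
Qed.

Lemma is_derive_subexponential c z : subexponential c -> `|z| < 1 ->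
  is_derive z (1 : R) (fun x => limn (pseries c x))
    (limn (pseries (pseries_diffs c) z)).
Proof.
move=> ct z1; pose K := (`|z| + 1) / 2.
have z0 := normr_ge0 z.
have K0 : 0 < K by rewrite /K; lra.
have K1 : `|K| < 1 by rewrite gtr0_norm // /K; lra.
apply: (@pseries_snd_diffs _ c K) => //.
- exact: subexponential_cvg.
- by apply: subexponential_cvg => //; exact: subexponential_diffs.
- by apply: subexponential_cvg => //; do 2! apply: subexponential_diffs.
- by rewrite (gtr0_norm K0) /K; lra.
Qed.

(* The index is reversed, so that the outermost summation variable comes first. *)
Fixpoint zeta_coef k (n : nat) : R :=
  if k is p :: k' then
    (n == (size k').+1 %[mod 2])%:R * 2 / n%:R ^+ p * \sum_(m < n) zeta_coef k' m
  else (n == 0)%:R.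

Lemma zeta_coef_ge0 k n : 0 <= zeta_coef k n.
Proof.
elim: k n => [|p k IH] n //=.
rewrite mulr_ge0 ?mulr_ge0 ?invr_ge0 ?exprn_ge0 // sumr_ge0 //.
Qed.

Lemma zeta_coef_cons0 p k : zeta_coef (p :: k) 0 = 0.
Proof. by rewrite /= big_ord0 mulr0. Qed.

Lemma zeta_coef_cons1 p k n :
  n%:R * zeta_coef (p.+1 :: k) n = zeta_coef (p :: k) n.
Proof.
case: n => [|n]; first by rewrite mul0r zeta_coef_cons0.
rewrite /= exprS; set S := \sum_(_ < _) _.
have n0 : n.+1%:R != 0 :> R by rewrite pnatr_eq0.
have n1 : n.+1%:R ^+ p != 0 :> R by rewrite expf_neq0.
by field; rewrite n1 nat1r.
Qed.

Lemma zeta_coef_parity k n : n != size k %[mod 2] -> zeta_coef k n = 0.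
Proof.
case: k => [|p k] /=; first by case: n => //; rewrite eqxx.
by move/negbTE => ->; rewrite !mul0r.
Qed.

(** For exponent [0] the coefficient is twice a partial sum of [zeta_coef k], or zero, according to
    parity. From [n] to [n + 2] the partial sum gains the terms at [n] and [n + 1], the first of
    which vanishes by parity. In the other parity class all three terms of the identity vanish. *)
Lemma zeta_coef_0SS k n :
  zeta_coef (0%N :: k) n.+2 = zeta_coef (0%N :: k) n + 2 * zeta_coef k n.+1.
Proof.
rewrite /= !expr0 !divr1 !big_ord_recr /=.
have -> : (n.+2 %% 2 = n %% 2)%N by rewrite -addn2 modnDr.
have [e|ne] := eqVneq (n %% 2)%N ((size k).+1 %% 2)%N.
  rewrite (@zeta_coef_parity k n) ?addr0 ?mul1r ?mulrDr //.
  by rewrite e -addn1 -modnDml; case: (size k %% 2)%N (ltn_pmod (size k) (isT : (0 < 2)%N)) => [|[]].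
rewrite !mul0r add0r zeta_coef_parity ?mulr0 //.
apply: contraNN ne => /eqP; rewrite -[n.+1]addn1 -[(size k).+1]addn1 => e.
by rewrite -(modnDml (size k)) -e modnDml -addnA addn1 modnDr.
Qed.

Lemma zeta_coef_01 k : zeta_coef (0%N :: k) 1 = 2 * zeta_coef k 0.
Proof.
rewrite /= expr0 divr1 big_ord1.
have [_|ne] := eqVneq; first by rewrite mul1r.
rewrite !mul0r zeta_coef_parity ?mulr0 //.
apply: contraNN ne => /eqP e.
by rewrite -[(size k).+1]addn1 -(modnDml (size k)) -e.
Qed.

Lemma subexponential_zeta_coef k : subexponential (zeta_coef k).
Proof.
elim: k => [|p k IH] /=.
  move=> q /andP[q0 q1]; exists 1 => -[|n] /=; first by rewrite normr1 expr0 mulr1.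
  by rewrite normr0 mul0r.
apply: (@subexponential_mul_bounded _ _ 2); first exact: subexponential_sum.
move=> n; rewrite -[leRHS]mulr1 !normrM; apply: ler_pM => //.
  rewrite !normr_nat; case: eqP => _ /=; last by rewrite mul0r.
  by rewrite mul1r.
rewrite normfV normrX normr_nat; case: n => [|n].
  by rewrite expr0n; case: p => [|p]; rewrite ?invr1 ?invr0.
by rewrite invf_le1 ?exprn_gt0 // exprn_ege1 // ler1n.
Qed.

Definition zeta_series k z : R := limn (pseries (zeta_coef k) z).

Lemma zeta_series_cvg k z : `|z| < 1 -> pseries (zeta_coef k) z @ \oo --> zeta_series k z.
Proof. by move=> z1; apply: subexponential_cvg => //; exact: subexponential_zeta_coef. Qed.

Lemma zeta_series_nil z : zeta_series [::] z = 1.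
Proof.
apply: lim_near_cst => //; exists 1%N => // -[|N] // _.
rewrite /pseries /series /= big_nat_recl // expr0 mulr1 big1 ?addr0 // => i _.
by rewrite mul0r.
Qed.

Lemma zeta_series_cons0 p k : zeta_series (p :: k) 0 = 0.
Proof.
apply: lim_near_cst => //; apply: nearW => N.
rewrite /pseries /series /= big_nat big1 // => -[|i] _ /=; last by rewrite expr0n mulr0.
by rewrite expr0 mulr1 -/(zeta_coef (p :: k) 0) zeta_coef_cons0.
Qed.

(** The operator [z d/dz] multiplies the coefficient at [n] by [n], which lowers the outermost
    exponent. *)
Lemma is_derive_zeta_series p k z : z != 0 -> `|z| < 1 ->
  is_derive z (1 : R) (zeta_series (p.+1 :: k)) (zeta_series (p :: k) z / z).
Proof.
move=> z0 z1.
have ct := @subexponential_zeta_coef (p.+1 :: k).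
have D := is_derive_subexponential ct z1.
apply: is_derive_eq D _.
have cd := subexponential_cvg (subexponential_diffs ct) z1.
apply: (mulIf z0); rewrite divfK //.
suff : pseries (zeta_coef (p :: k)) z @ \oo -->
    limn (pseries (pseries_diffs (zeta_coef (p.+1 :: k))) z) * z.
  by move=> /cvg_lim <- //.
(* The constant coefficient vanishes, so the shifted partial sums are [z] times those of the
   derivative series. *)
rewrite -cvg_shiftS.
have -> : [sequence pseries (zeta_coef (p :: k)) z n.+1]_n =
  (fun n => pseries (pseries_diffs (zeta_coef (p.+1 :: k))) z n * z).
  apply/funext => n /=; rewrite /pseries /series /=.
  rewrite big_nat_recl // -/(zeta_coef (p :: k) 0) zeta_coef_cons0 mul0r add0r.
  rewrite mulr_suml; apply: eq_bigr => i _.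
  rewrite /pseries_diffs -/(zeta_coef (p.+1 :: k) _) zeta_coef_cons1 exprSr.
  by rewrite mulrA.
exact: cvgMr_tmp cd.
Qed.

(** Formally, a geometric series in the outermost variable replaces [z^m] by
    [2 z^(m+1) / (1 - z^2)]. Here it is read off the two-step recurrence of the coefficients, whose
    limit is [C = z^2 C + 2 z A]. *)
Lemma zeta_series_0 k z : `|z| < 1 ->
  zeta_series (0%N :: k) z = 2 * z / (1 - z ^+ 2) * zeta_series k z.
Proof.
move=> z1.
have z20 : 1 - z ^+ 2 != 0.
  by rewrite subr_eq0 eq_sym lt_eqF // -real_normK ?num_real // expr_lt1.
set C := zeta_series (0%N :: k) z; set A := zeta_series k z.
suff : C = z ^+ 2 * C + 2 * z * A.
  by move=> e; apply: (mulIf z20); rewrite mulrAC divfK //; move: e; lra.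
have cC := @zeta_series_cvg (0%N :: k) z z1.
have cA := @zeta_series_cvg k z z1.
suff : pseries (zeta_coef (0%N :: k)) z @ \oo --> z ^+ 2 * C + 2 * z * A.
  by move=> /cvg_lim <- //.
rewrite -(cvg_shiftn 2).
have -> : (fun n => pseries (zeta_coef (0%N :: k)) z (n + 2)%N) =
  (fun n => z ^+ 2 * pseries (zeta_coef (0%N :: k)) z n
            + 2 * z * pseries (zeta_coef k) z (n + 1)%N).
  apply/funext => n; rewrite /pseries /series /= addn2 addn1.
  rewrite !big_nat_recl // -/(zeta_coef (0%N :: k) 0) zeta_coef_cons0.
  rewrite -/(zeta_coef (0%N :: k) 1) zeta_coef_01 mul0r add0r mulrDr.
  rewrite addrCA !mulr_sumr -big_split /=; congr (_ + _); first by rewrite expr0 expr1; ring.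
  apply: eq_bigr => i _.
  by rewrite -/(zeta_coef (0%N :: k) i.+2) zeta_coef_0SS -/(zeta_coef (0%N :: k) i) !exprS; ring.
apply: cvgD; first exact: cvgMl_tmp.
by apply: cvgMl_tmp; rewrite (cvg_shiftn 1).
Qed.

End PowerSeries.

(** * Calculus of derivatives *)

Section Derivation.
Local Open Scope classical_set_scope.
Local Open Scope ring_scope.
Variable R : realType.
Implicit Types (f g df : R -> R) (t u x a b c : R).

Lemma is_derive_add f g t a b : is_derive t (1 : R) f a -> is_derive t (1 : R) g b ->
  is_derive t (1 : R) (fun u => f u + g u) (a + b).
Proof. exact: is_deriveD. Qed.

Lemma is_derive_opp f t a : is_derive t (1 : R) f a ->
  is_derive t (1 : R) (fun u => - f u) (- a).
Proof. exact: is_deriveN. Qed.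

Lemma is_derive_mul f g t a b : is_derive t (1 : R) f a -> is_derive t (1 : R) g b ->
  is_derive t (1 : R) (fun u => f u * g u) (a * g t + f t * b).
Proof.
move=> df dg; apply: is_derive_eq (is_deriveM df dg) _.
by rewrite /GRing.scale /=; ring.
Qed.

Lemma is_derive_scale f c t a : is_derive t (1 : R) f a ->
  is_derive t (1 : R) (fun u => c * f u) (c * a).
Proof. exact: is_deriveZ. Qed.

Lemma is_derive_inv f t a : f t != 0 -> is_derive t (1 : R) f a ->
  is_derive t (1 : R) (fun u => (f u)^-1) (- a / f t ^+ 2).
Proof.
move=> ft df; apply: is_derive_eq (is_deriveV ft df) _.
by rewrite /GRing.scale /= mulNr mulrC mulNr.
Qed.

Lemma is_derive_comp f g t a b : is_derive (g t) (1 : R) f a ->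
  is_derive t (1 : R) g b -> is_derive t (1 : R) (fun u => f (g u)) (a * b).
Proof. exact: is_derive1_comp. Qed.

Lemma is_derive_const c t : is_derive t (1 : R) (fun=> c) 0.
Proof. exact: is_derive_cst. Qed.

Lemma is_derive_var t : is_derive t (1 : R) (fun u => u) 1.
Proof. exact: is_derive_id. Qed.

Lemma is_derive_bigsum n (f : nat -> R -> R) (df : nat -> R) t :
  (forall i, (i < n)%N -> is_derive t (1 : R) (f i) (df i)) ->
  is_derive t (1 : R) (fun u => \sum_(i < n) f i u) (\sum_(i < n) df i).
Proof.
elim: n => [_|n IH H].
  rewrite big_ord0; under eq_fun do rewrite big_ord0.
  exact: is_derive_const.
rewrite big_ord_recr; under eq_fun do rewrite big_ord_recr.
apply: is_derive_add; last exact: H.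
by apply: IH => i ni; apply: H; rewrite ltnW.
Qed.

Definition monomial n t := t ^+ n / n`!%:R : R.

Lemma is_derive_monomial n t :
  is_derive t (1 : R) (monomial n) (if n is n'.+1 then monomial n' t else 0).
Proof.
have -> : monomial n = (fun u => n`!%:R^-1 * u ^+ n).
  by apply/funext => u; rewrite /monomial mulrC.
have D : is_derive t (1 : R) (fun u => u ^+ n) (n%:R * t ^+ n.-1).
  elim: n => [|n IH]; first by rewrite mul0r; exact: is_derive_const.
  under eq_fun do rewrite exprS.
  apply: is_derive_eq (is_derive_mul (is_derive_var t) IH) _.
  by case: n {IH} => [|n] /=; rewrite -?natr1 ?exprS; ring.
apply: is_derive_eq (is_derive_scale _ D) _.
case: n D => [|n] _; first by rewrite mul0r mulr0.
rewrite /monomial factS natrM /=; field.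
by rewrite nat1r !pnatr_eq0 -lt0n fact_gt0.
Qed.

Lemma is_derive_continuous f t a : is_derive t (1 : R) f a -> {for t, continuous f}.
Proof.
by move=> [df _]; exact/differentiable_continuous/derivable1_diffP.
Qed.

Lemma ge0_derive_ge0 f df : (forall x, is_derive x (1 : R) f (df x)) -> f 0 = 0 ->
  (forall x, 0 < x -> 0 <= df x) -> forall x, 0 <= x -> 0 <= f x.
Proof.
move=> Df f0 df0 x; rewrite le_eqVlt => /predU1P[<-|x0]; first by rewrite f0.
have [|c] := @MVT R f df 0 x x0 (fun u _ => Df u).
  by apply: continuous_subspaceT => u; exact: is_derive_continuous (Df u).
rewrite in_itv /= f0 !subr0 => /andP[c0 _] ->.
by rewrite mulr_ge0 ?df0 // ltW.
Qed.

(** Limits at [0+] replace values at [0], because the functions compared later involve the series of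
    exponent [1], which diverges at [z = 1]. *)
Lemma eq_derive_eq f g df :
  (forall t, 0 < t -> is_derive t (1 : R) f (df t)) ->
  (forall t, 0 < t -> is_derive t (1 : R) g (df t)) ->
  f x @[x --> 0^'+] --> 0 -> g x @[x --> 0^'+] --> 0 ->
  forall t, 0 < t -> f t = g t.
Proof.
move=> Hf Hg f0 g0 t t0; pose h u := f u - g u.
have dh u : 0 < u -> is_derive u (1 : R) h 0.
  move=> u0; rewrite -(subrr (df u)).
  by apply: is_derive_add; [exact: Hf|apply: is_derive_opp; exact: Hg].
have hc x : 0 < x -> x < t -> h x = h t.
  move=> x0 xt; apply/eqP; rewrite eq_sym -subr_eq0.
  have [||c _ ->] := @MVT _ h (fun=> 0) x t xt; last by rewrite mul0r.
    by move=> y /[!in_itv] /= /andP[xy _]; apply: dh; exact: lt_trans xy.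
  apply: continuous_in_subspaceT => y /[!inE] /=.
  rewrite in_itv /= => /andP[xy _].
  by apply: is_derive_continuous (dh y _); exact: lt_le_trans xy.
have : h x @[x --> 0^'+] --> 0 - 0 by apply: cvgB.
rewrite subr0 => h0.
have : h x @[x --> 0^'+] --> h t.
  apply: cvg_near_cst; near=> x; apply: hc => //.
move=> /(cvg_unique (@norm_hausdorff _ _)) /(_ h0) /eqP.
by rewrite /h subr_eq0 => /eqP.
Unshelve. all: by end_near. Qed.

End Derivation.

(** * The substitution z = tanh (t / 2) *)

Section Hyperbolic.
Local Open Scope classical_set_scope.
Local Open Scope ring_scope.
Variable R : realType.
Implicit Types (t u z : R) (k : seq nat).

Lemma tanh_halfE t : tanh (t / 2) = (expR t - 1) / (expR t + 1).
Proof.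
have e : expR t = expR (t / 2) ^+ 2 by rewrite expr2 -expRD -splitr.
rewrite /tanh /sinh /cosh expRN e; have p := expR_gt0 (t / 2).
by field; rewrite !gt_eqF //; nra.
Qed.

Lemma sinhE t : sinh t = (expR t ^+ 2 - 1) / (2 * expR t).
Proof. by rewrite /sinh expRN; have p := expR_gt0 t; field; rewrite gt_eqF. Qed.

Lemma sinh_gt0 t : 0 < t -> 0 < sinh t.
Proof.
move=> t0; rewrite sinhE; have e := pexpR_gt1 t0.
by apply: divr_gt0; nra.
Qed.

Lemma tanh_half_gt0 t : 0 < t -> 0 < tanh (t / 2).
Proof.
move=> t0; rewrite tanh_halfE; have e := pexpR_gt1 t0.
by apply: divr_gt0; lra.
Qed.

Lemma tanh_half_lt1 t : `|tanh (t / 2)| < 1.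
Proof.
rewrite tanh_halfE; have e := expR_gt0 t.
rewrite ltr_norml ltr_pdivlMr ?ltr_pdivrMr; lra.
Qed.

Lemma is_derive_tanh_half t :
  is_derive t (1 : R) (fun u => tanh (u / 2)) ((1 - tanh (t / 2) ^+ 2) / 2).
Proof.
under eq_fun do rewrite tanh_halfE.
have p := expR_gt0 t.
have De c : is_derive t (1 : R) (fun u => expR u + c) (expR t).
  rewrite -[X in is_derive _ _ _ X]addr0.
  by apply: is_derive_add; exact: is_derive_const.
have n0 : expR t + 1 != 0 by rewrite gt_eqF //; lra.
apply: is_derive_eq (is_derive_mul (De (-1)) (is_derive_inv (f := fun u => expR u + 1) n0 (De 1))) _.
by rewrite tanh_halfE; field.
Qed.

(** This is the logarithmic derivative of [tanh (t / 2)], the factor that the chain rule attaches to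
    [z d/dz]. *)
Lemma inv_sinh_tanh_half t : 0 < t ->
  (1 - tanh (t / 2) ^+ 2) / 2 / tanh (t / 2) = (sinh t)^-1.
Proof.
move=> t0; rewrite tanh_halfE sinhE; have e := pexpR_gt1 t0.
field; rewrite !gt_eqF //; nra.
Qed.

Lemma expRN_lt1 t : 0 < t -> `|expR (- t)| < 1.
Proof. by move=> t0; rewrite gtr0_norm ?expR_gt0 // expR_lt1; lra. Qed.

(** For [z = e^(-t)] one has [2 z / (1 - z^2) = 1 / sinh t], so division by [sinh] amounts to
    prepending an exponent [0]. *)
Lemma zeta_series_0_expN k t : 0 < t ->
  zeta_series (0%N :: k) (expR (- t)) = zeta_series k (expR (- t)) / sinh t.
Proof.
move=> t0; rewrite zeta_series_0 ?expRN_lt1 // [RHS]mulrC; congr (_ * _).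
rewrite sinhE expRN; have e := pexpR_gt1 t0.
by field; rewrite !gt_eqF //; nra.
Qed.

(** For [z = tanh (t / 2)] the exponent [0] gives the factor [2 z / (1 - z^2) = sinh t], which
    cancels the [1 / sinh t] of the chain rule. *)
Lemma is_derive_zeta_tanh1 k t : 0 < t ->
  is_derive t (1 : R) (fun u => zeta_series (1%N :: k) (tanh (u / 2)))
    (zeta_series k (tanh (t / 2))).
Proof.
move=> t0; have z0 := tanh_half_gt0 t0; have z1 := tanh_half_lt1 t.
have D := is_derive_comp (g := fun u => tanh (u / 2))
  (is_derive_zeta_series 0 k (lt0r_neq0 z0) z1)
  (is_derive_tanh_half t).
apply: is_derive_eq D _; rewrite zeta_series_0 //.
have : tanh (t / 2) ^+ 2 < 1 by rewrite -real_normK ?num_real // expr_lt1.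
set z := tanh (t / 2) in z0 z1 *; move=> z2.
by field; rewrite (gt_eqF z0) gt_eqF //; lra.
Qed.

Lemma is_derive_zeta_tanhSS p k t : 0 < t ->
  is_derive t (1 : R) (fun u => zeta_series (p.+2 :: k) (tanh (u / 2)))
    (zeta_series (p.+1 :: k) (tanh (t / 2)) / sinh t).
Proof.
move=> t0; have z0 := tanh_half_gt0 t0; have z1 := tanh_half_lt1 t.
have D := is_derive_comp (g := fun u => tanh (u / 2))
  (is_derive_zeta_series p.+1 k (lt0r_neq0 z0) z1)
  (is_derive_tanh_half t).
apply: is_derive_eq D _; rewrite -inv_sinh_tanh_half //; field.
by rewrite gt_eqF.
Qed.

Lemma is_derive_expN t : is_derive t (1 : R) (fun u => expR (- u)) (- expR (- t)).
Proof.
apply: is_derive_eq (is_derive_comp (g := fun u => - u) (is_derive_expR (- t))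
  (is_derive_opp (is_derive_var t))) _.
by rewrite mulrN1.
Qed.

Lemma is_derive_zeta_expN p k t : 0 < t ->
  is_derive t (1 : R) (fun u => zeta_series (p.+1 :: k) (expR (- u)))
    (- zeta_series (p :: k) (expR (- t))).
Proof.
move=> t0; have z1 := expRN_lt1 t0; have z0 := expR_gt0 (- t).
have D := is_derive_comp (g := fun u => expR (- u))
  (is_derive_zeta_series p k (lt0r_neq0 z0) z1)
  (is_derive_expN t).
by apply: is_derive_eq D _; field; rewrite gt_eqF.
Qed.

Lemma zeta_tanh_cvg0 p k : zeta_series (p :: k) (tanh (t / 2)) @[t --> (0:R)^'+] --> (0:R).
Proof.
apply: cvg_at_right_filter.
have th0 : tanh (0 / 2) = 0 :> R by rewrite tanh_halfE expR0 subrr mul0r.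
have c1 : {for 0, continuous (fun t : R => tanh (t / 2))}.
  exact: is_derive_continuous (is_derive_tanh_half 0).
have c2 : {for tanh ((0:R) / 2), continuous (zeta_series (p :: k))}.
  apply: is_derive_continuous (is_derive_subexponential (@subexponential_zeta_coef R _) _).
  exact: tanh_half_lt1.
have e : zeta_series (p :: k) (tanh (0 / 2)) = 0 :> R by rewrite th0 zeta_series_cons0.
rewrite -[X in _ --> X]e; exact: continuous_comp c1 c2.
Qed.

Lemma monomial_cvg n : monomial n t @[t --> (0:R)^'+] --> monomial n (0:R).
Proof.
apply: cvg_at_right_filter.
exact: is_derive_continuous (is_derive_monomial n 0).
Qed.

Lemma monomial0 n : monomial n (0:R) = (n == 0)%:R.
Proof. by rewrite /monomial expr0n; case: n => [|n]; rewrite ?mul0r // divr1. Qed.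

Lemma zeta_tanh_nseq1 r t : 0 < t ->
  zeta_series (nseq r 1%N) (tanh (t / 2)) = monomial r t.
Proof.
elim: r t => [|r IH] t; first by rewrite /= zeta_series_nil /monomial expr0 divr1.
apply: (@eq_derive_eq _ (fun u => zeta_series (nseq r.+1 1%N) (tanh (u / 2)))
  (monomial r.+1) (fun u => zeta_series (nseq r 1%N) (tanh (u / 2)))).
- exact: is_derive_zeta_tanh1.
- by move=> u u0; rewrite IH //; exact: is_derive_monomial.
- exact: zeta_tanh_cvg0.
- by have := @monomial_cvg r.+1; rewrite monomial0.
Qed.

End Hyperbolic.

(** * Behaviour at 0 and 1 *)

Section BoundaryValues.
Local Open Scope classical_set_scope.
Local Open Scope ring_scope.
Variable R : realType.
Implicit Types (t u z : R) (k : seq nat).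

Lemma zeta_coef1E p n :
  zeta_coef R [:: p] n = if odd n then 2 / n%:R ^+ p else 0.
Proof.
rewrite /= modn2 [(1 %% 2)%N]/=.
have -> : \sum_(m < n) ((nat_of_ord m == 0%N)%:R : R) = (0 < n)%N%:R.
  case: n => [|n]; first by rewrite big_ord0.
  by rewrite big_ord_recl big1 ?addr0.
case: n => [|n] //=; first by rewrite mulr0.
rewrite mulr1; case: (odd n); rewrite /= ?mul0r ?mul1r //.
Qed.

Lemma pseries_zeta_nondecreasing k z : 0 <= z ->
  nondecreasing_seq (pseries (zeta_coef R k) z).
Proof.
move=> z0; apply/nondecreasing_seqP => n.
rewrite /pseries /series /= big_nat_recr //= lerDl.
by rewrite mulr_ge0 ?zeta_coef_ge0 ?exprn_ge0.
Qed.

Lemma pseries_zeta_le k z N : 0 <= z < 1 ->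
  pseries (zeta_coef R k) z N <= zeta_series k z.
Proof.
move=> /andP[z0 z1]; apply: nondecreasing_cvgn_le.
  exact: pseries_zeta_nondecreasing.
by apply/cvg_ex; eexists; apply: zeta_series_cvg; rewrite ger0_norm.
Qed.

Lemma zeta_series_ge0 k z : 0 <= z < 1 -> 0 <= zeta_series k z.
Proof.
move=> z01; apply: le_trans (pseries_zeta_le k 0%N z01).
by rewrite /pseries /series /= big_nil.
Qed.

Lemma zeta_series1_le p z : 0 <= z < 1 ->
  zeta_series [:: p] z <= zeta_series [:: 0%N] z.
Proof.
move=> /andP[z0 z1]; have nz : `|z| < 1 by rewrite ger0_norm.
apply: ler_lim.
- by apply/cvg_ex; eexists; exact: zeta_series_cvg.
- by apply/cvg_ex; eexists; exact: zeta_series_cvg.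
- apply: nearW => N; apply: ler_sum => n _; apply: ler_wpM2r; first exact: exprn_ge0.
  rewrite !zeta_coef1E; case: ifP => // on; rewrite expr0 divr1.
  rewrite ler_pdivrMr; last by rewrite exprn_gt0 // ltr0n odd_gt0.
  by rewrite ler_peMr // exprn_ege1 // ler1n odd_gt0.
Qed.

Lemma zeta_series1_cvg p : cvgn (pseries (zeta_coef R [:: p.+2]) 1).
Proof.
apply: nondecreasing_is_cvgn; first exact: pseries_zeta_nondecreasing.
exists 4 => _ [N _ <-].
apply: (@le_trans _ _ (pseries (zeta_coef R [:: p.+2]) 1 N.+2)).
  by apply: pseries_zeta_nondecreasing => //; rewrite -addn2 leq_addr.
(* Telescoping by [2 / n^2 <= 2 / (n - 1) - 2 / n]; the constant [4] is the term [2] at [n = 1] plus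
   a telescoped total below [2]. *)
suff : pseries (zeta_coef R [:: p.+2]) 1 N.+2 <= 4 - 2 / N.+1%:R.
  by move=> H; apply: le_trans H _; rewrite gerBl.
elim: N => [|N IH].
  rewrite /pseries /series /= 2!big_cons big_nil !expr1n.
  by rewrite /= big_ord1 /=; lra.
rewrite /pseries /series /= big_nat_recr //=.
apply: le_trans (lerD IH (lexx _)) _.
rewrite -/(zeta_coef R [:: p.+2] _) zeta_coef1E expr1n mulr1.
apply: (@le_trans _ _ (4 - 2 / N.+1%:R + 2 / (N.+1%:R * N.+2%:R))); last first.
  have n0 : 0 < N.+1%:R :> R by [].
  have n2 : 0 < N.+2%:R :> R by [].
  have e : N.+2%:R = N.+1%:R + 1 :> R by rewrite natr1.
  rewrite e in n2 *.
  set x := N.+1%:R in n0 n2 *.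
  by rewrite le_eqVlt; apply/orP; left; apply/eqP; field; rewrite !gt_eqF.
rewrite lerD2l; case: ifP => _; last by rewrite divr_ge0 // mulr_ge0.
rewrite ler_pM2l // lef_pV2 ?posrE ?exprn_gt0 ?mulr_gt0 //.
rewrite exprSr ler_pM // ?exprn_ge0 //; last first.
apply: (@le_trans _ _ N.+2%:R); first by rewrite ler_nat.
by rewrite exprS ler_peMr // exprn_ege1 // ler1n.
Qed.

Lemma pseries_zeta_le1 p z N : 0 <= z <= 1 ->
  pseries (zeta_coef R [:: p.+2]) z N <= zeta_series [:: p.+2] 1.
Proof.
move=> /andP[z0 z1].
apply: (@le_trans _ _ (pseries (zeta_coef R [:: p.+2]) 1 N)); last first.
  apply: nondecreasing_cvgn_le; last exact: zeta_series1_cvg.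
  exact: pseries_zeta_nondecreasing.
apply: ler_sum => n _; apply: ler_wpM2l; first exact: zeta_coef_ge0.
by rewrite expr1n exprn_ile1.
Qed.

Lemma zeta_series_le1 p z : 0 <= z < 1 ->
  zeta_series [:: p.+2] z <= zeta_series [:: p.+2] 1.
Proof.
move=> /andP[z0 z1]; apply: limr_le.
  by apply/cvg_ex; eexists; apply: zeta_series_cvg; rewrite ger0_norm.
by apply: nearW => N; apply: pseries_zeta_le1; rewrite z0 ltW.
Qed.

Lemma cvg_bigsum (S I : Type) (F : set_system S) (FF : Filter F) (r : seq I)
    (f : I -> S -> R) (l : I -> R) : (forall i, f i x @[x --> F] --> l i) ->
  \sum_(i <- r) f i x @[x --> F] --> \sum_(i <- r) l i.
Proof.
move=> H; elim: r => [|i r IH].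
  rewrite big_nil; under eq_fun do rewrite big_nil.
  exact: cvg_cst.
rewrite big_cons; under eq_fun do rewrite big_cons.
by apply: cvgD.
Qed.

Lemma expRN_cvg1 : expR (- t) @[t --> (0:R)^'+] --> (1:R).
Proof.
apply: cvg_at_right_filter.
have e : expR (- 0) = 1 :> R by rewrite oppr0 expR0.
rewrite -[X in _ --> X]e; exact: is_derive_continuous (is_derive_expN (0:R)).
Qed.

(* The convergence is monotone in both the truncation and the argument, hence the
   two limits can be exchanged. *)
Lemma zeta_expN_cvg p :
  zeta_series [:: p.+2] (expR (- t)) @[t --> (0:R)^'+] --> zeta_series [:: p.+2] (1:R).
Proof.
apply/cvgrPdist_le => e e0.
have /cvgrPdist_lt /(_ (e / 2)) : pseries (zeta_coef R [:: p.+2]) 1 @ \oo --> zeta_series [:: p.+2] 1.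
  exact: zeta_series1_cvg.
have e20 : 0 < e / 2 by lra.
move=> /(_ e20) [N _ /(_ N (leqnn N))] /= hN.
have c : pseries (zeta_coef R [:: p.+2]) (expR (- t)) N @[t --> (0:R)^'+] -->
    pseries (zeta_coef R [:: p.+2]) 1 N.
  apply: cvg_bigsum => n; apply: cvgM; first exact: cvg_cst.
  apply: (@cvg_comp _ _ _ (fun t : R => expR (- t)) (fun x => x ^+ n) _ _ _ expRN_cvg1).
  exact: exprn_continuous.
near=> t.
have t0 : 0 < t by [].
have z01 : 0 <= expR (- t) < 1.
  by rewrite expR_ge0 -[X in X < _]ger0_norm ?expR_ge0 // expRN_lt1.
have := zeta_series_le1 p z01.
have := pseries_zeta_le [:: p.+2] N z01.
have : `|pseries (zeta_coef R [:: p.+2]) 1 N - pseries (zeta_coef R [:: p.+2]) (expR (- t)) N| < e / 2.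
  by near: t; move/cvgrPdist_lt : c => /(_ _ e20).
move: hN; rewrite !ltr_norml => /andP[h1 h2] /andP[h3 h4] h5 h6.
by rewrite ger0_norm ?subr_ge0 //; lra.
Unshelve. all: by end_near. Qed.

(** Applying [ln x < x] to [x = 1 / sqrt t] gives [- t ln t <= 2 sqrt t]. *)
Lemma mul_ln_cvg0 : t * ln t @[t --> (0:R)^'+] --> (0:R).
Proof.
have s0 : - (2 * Num.sqrt t) @[t --> (0:R)^'+] --> (0:R).
  rewrite -[X in _ --> X]oppr0; apply: cvgN.
  rewrite -[X in _ --> X](mulr0 2); apply: cvgM; first exact: cvg_cst.
  rewrite -[X in _ --> X]sqrtr0; apply: cvg_at_right_filter; exact: sqrt_continuous.
apply: (squeeze_cvgr _ s0 (cvg_cst 0)).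
near=> t; have t0 : 0 < t by []; have t1 : t < 1 by near: t; exact: nbhs_right_lt.
apply/andP; split; last by rewrite pmulr_rle0 // ln_le0 // ltW.
set q := Num.sqrt t; have q0 : 0 < q by rewrite sqrtr_gt0.
have tq : t = q ^+ 2 by rewrite sqr_sqrtr // ltW.
rewrite tq lnXn // -mulrN.
have : ln q^-1 < q^-1 by apply: ln_sublinear; rewrite invr_gt0.
rewrite lnV ?posrE // => h.
rewrite -mulr_natr.
have : q ^+ 2 * - ln q <= q ^+ 2 * q^-1 by rewrite ler_pM2l ?exprn_gt0 // ltW.
by rewrite expr2 -(mulrA q q q^-1) divff ?gt_eqF // mulr1; lra.
Unshelve. all: by end_near. Qed.

Lemma sinh_ge t : 0 <= t -> t <= sinh t.
Proof.
rewrite le_eqVlt => /predU1P[<-|t0].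
  by rewrite /sinh oppr0 subrr mul0r.
pose f u := sinh u - u.
have Df u : is_derive u (1 : R) f ((expR u + expR (- u)) / 2 - 1).
  apply: is_derive_eq (is_derive_add
    (is_derive_mul (f := fun u => expR u - expR (- u)) (g := fun=> 2^-1)
      (is_derive_add (is_derive_expR u) (is_derive_opp (is_derive_expN u)))
      (is_derive_const _ _)) (is_derive_opp (is_derive_var u))) _.
  by rewrite opprK mulr0 addr0.
rewrite -subr_ge0; apply: (ge0_derive_ge0 Df) (ltW t0).
  by rewrite /f /sinh oppr0 subrr mul0r addr0.
move=> c _; rewrite expRN; have p := expR_gt0 c.
have -> : (expR c + (expR c)^-1) / 2 - 1 = (expR c - 1) ^+ 2 / (2 * expR c).
  by field; rewrite gt_eqF.
by rewrite divr_ge0 ?sqr_ge0 // mulr_ge0 // ltW.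
Qed.

(** The singularity is at most logarithmic: [V + ln] has derivative [1 / u - 1 / sinh u >= 0], so
    [V t <= V 1 - ln t] on [(0, 1)]. *)
Lemma mul_zeta1_expN_cvg0 : t * zeta_series [:: 1%N] (expR (- t)) @[t --> (0:R)^'+] --> (0:R).
Proof.
pose V u := zeta_series [:: 1%N] (expR (- u)).
pose f u := V u + ln u.
have Df u : 0 < u -> is_derive u (1 : R) f (- (sinh u)^-1 + u^-1).
  move=> u0; apply: is_derive_add; last exact: is_derive1_ln.
  apply: is_derive_eq (is_derive_zeta_expN 0 [::] u0) _.
  by rewrite zeta_series_0_expN // zeta_series_nil mul1r.
have V1 t : 0 < t -> t < 1 -> V t <= V 1 - ln t.
  move=> t0 t1.
  have [||c] := @MVT _ f (fun u => - (sinh u)^-1 + u^-1) t 1 t1.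
    by move=> u /[!in_itv] /= /andP[tu _]; apply: Df; exact: lt_trans tu.
    apply: continuous_in_subspaceT => y /[!inE] /=.
    rewrite in_itv /= => /andP[ty _].
    by apply: is_derive_continuous (Df y _); exact: lt_le_trans ty.
  rewrite in_itv /= => /andP[tc c1]; rewrite /f ln1 addr0 => e.
  have c0 : 0 < c by exact: lt_trans tc.
  have : 0 <= (- (sinh c)^-1 + c^-1) * (1 - t).
    rewrite mulr_ge0 ?subr_ge0 ?(ltW t1) // addrC subr_ge0 lef_pV2 ?posrE ?sinh_gt0 //.
    by rewrite sinh_ge // ltW.
  by rewrite -e; lra.
have c1 : t * V 1 - t * ln t @[t --> (0:R)^'+] --> (0:R).
  rewrite -[X in _ --> X]subr0; apply: cvgB; last exact: mul_ln_cvg0.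
  rewrite -[X in _ --> X](mul0r (V 1)); apply: cvgM; last exact: cvg_cst.
  by apply: cvg_at_right_filter; exact: cvg_id.
apply: (squeeze_cvgr _ (cvg_cst 0) c1).
near=> t; have t0 : 0 < t by []; have t1 : t < 1 by near: t; exact: nbhs_right_lt.
rewrite -mulrBr ler_pM2l // V1 // andbT mulr_ge0 ?(ltW t0) // zeta_series_ge0 //.
by rewrite expR_ge0 -[X in X < _]ger0_norm ?expR_ge0 // expRN_lt1.
Unshelve. all: by end_near. Qed.

End BoundaryValues.

(** * The expansion of A *)

Section Expansion.
Local Open Scope classical_set_scope.
Local Open Scope ring_scope.
Variable R : realType.
Implicit Types (t u : R).

(** The expansion uses it with [j >= 1]: for [j = 0] the term [i = 0] would contain the divergent
    series [zeta_series [:: 1] 1]. *)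
Definition polynomial_part (j m : nat) t : R :=
  \sum_(i < m.+1) (-1) ^+ i * 'C(i + j, i)%:R * zeta_series [:: (i + j).+1] 1
    * monomial (m - i) t.

Definition decaying_part (j m : nat) t : R :=
  \sum_(a < j.+1) 'C(a + m, m)%:R * (monomial (j - a) t
    * zeta_series [:: (a + m).+1] (expR (- t))).

(** The coefficients depend on [i] and [j] but not on [m], so differentiation only lowers the
    degrees and drops the last term. *)
Lemma is_derive_polynomial_part j m t :
  is_derive t (1 : R) (polynomial_part j m)
    (if m is m'.+1 then polynomial_part j m' t else 0).
Proof.
pose c i : R := (-1) ^+ i * 'C(i + j, i)%:R * zeta_series [:: (i + j).+1] 1.
pose f i u := c i * monomial (m - i) u.
pose df i : R := c i * (if (m - i)%N is q.+1 then monomial q t else 0).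
have D i : (i < m.+1)%N -> is_derive t (1 : R) (f i) (df i).
  by move=> _; exact: is_derive_scale (is_derive_monomial (m - i) t).
apply: is_derive_eq (is_derive_bigsum D) _; rewrite /df /c {D f df c}.
case: m => [|m]; first by rewrite big_ord1 mulr0.
rewrite big_ord_recr /= subnn mulr0 addr0; apply: eq_bigr => i _.
by rewrite subSn // -ltnS.
Qed.

(* Differentiating the product shifts [a] in one of the two sums; the coefficients
   then combine by Pascal's rule. *)
Lemma is_derive_decaying_part j m t : 0 < t ->
  is_derive t (1 : R) (decaying_part j m)
    (- (if m is m'.+1 then decaying_part j m' t else monomial j t / sinh t)).
Proof.
move=> t0; pose V p u := zeta_series [:: p] (expR (- u)) : R.
pose f a u := 'C(a + m, m)%:R * (monomial (j - a) u * V (a + m).+1 u).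
pose df a : R := 'C(a + m, m)%:R *
  ((if (j - a)%N is q.+1 then monomial q t else 0) * V (a + m).+1 t +
   monomial (j - a) t * - V (a + m)%N t).
have Df a : (a < j.+1)%N -> is_derive t (1 : R) (f a) (df a).
  move=> _; exact: is_derive_scale (is_derive_mul (is_derive_monomial (j - a) t)
    (is_derive_zeta_expN (a + m) [::] t0)).
apply: is_derive_eq (is_derive_bigsum Df) _; rewrite /df {Df f df}.
pose D a : R := if a is a'.+1 then 'C(a' + m, m)%:R else 0.
have -> : \sum_(a < j.+1) 'C(a + m, m)%:R *
    ((if (j - a)%N is q.+1 then monomial q t else 0) * V (a + m).+1 t +
     monomial (j - a) t * - V (a + m)%N t) =
  \sum_(a < j.+1) (D a - 'C(a + m, m)%:R) * (monomial (j - a) t * V (a + m)%N t).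
  under eq_bigr do rewrite mulrDr.
  under [RHS]eq_bigr do rewrite mulrBl.
  rewrite !big_split /=; congr (_ + _); last first.
    by apply: eq_bigr => a _; rewrite !mulrN.
  rewrite big_ord_recr /= subnn mul0r mulr0 addr0.
  rewrite big_ord_recl /= mul0r add0r; apply: eq_bigr => a _.
  by rewrite /bump leq0n add1n -[(j - a)%N]prednK ?subn_gt0 // -subnS.
(* For [m = 0] all binomials are [1], so the differences vanish except at [a = 0], where the series
   of exponent [0] is [1 / sinh t]. *)
case: m @D => [|m] D.
  rewrite big_ord_recl big1 => [|a _].
    rewrite /D /= subn0 addn0 bin0 sub0r mulN1r addr0 /V.
    by rewrite zeta_series_0_expN // zeta_series_nil mul1r.
  by rewrite /D /= !bin0 subrr mul0r.
rewrite /decaying_part -sumrN; apply: eq_bigr => a _.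
rewrite addnS -mulNr /V; congr (_ * _).
rewrite /D; case: (nat_of_ord a) => [|a'].
  by rewrite !add0n !binn sub0r.
by rewrite !addSn !addnS (binS (a' + m).+1) natrD; ring.
Qed.

(** Every term but [a = j + 1] has a positive power of [t] against a series that is bounded near [0]
    or, when [a + m = 0], logarithmic. With [j.+1] in place of [j], the logarithmic term is never
    the surviving one. *)
Lemma decaying_part_cvg0 j m :
  decaying_part j.+1 m t @[t --> (0:R)^'+] -->
    'C(j.+1 + m, m)%:R * zeta_series [:: (j.+1 + m).+1] (1:R).
Proof.
have -> : 'C(j.+1 + m, m)%:R * zeta_series [:: (j.+1 + m).+1] (1:R) =
  \sum_(a < j.+2) 'C(a + m, m)%:R *
    (if a == j.+1 :> nat then zeta_series [:: (j.+1 + m).+1] (1:R) else 0).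
  rewrite big_ord_recr /= eqxx big1 ?add0r // => a _.
  by rewrite ltn_eqF ?mulr0.
apply: cvg_bigsum => a; apply: cvgM; first exact: cvg_cst.
have : (a <= j.+1)%N by rewrite -ltnS.
rewrite leq_eqVlt; case: eqP => [-> _|_ /= aj].
  under eq_fun do rewrite subnn /monomial expr0 divr1 mul1r.
  by rewrite addSn; exact: zeta_expN_cvg.
rewrite subSn //; case e: (a + m)%N => [|b].
  pose f t := monomial (j - a) t * (j - a).+1%:R^-1 * (t * zeta_series [:: 1%N] (expR (- t))).
  have -> : (fun t => monomial (j - a).+1 t * zeta_series [:: 1%N] (expR (- t))) = f.
    apply/funext => t; rewrite /f /monomial factS natrM exprSr; field.
    by rewrite nat1r !pnatr_eq0 -!lt0n fact_gt0.
  rewrite -[X in _ --> X](mulr0 (monomial (j - a) 0 * (j - a).+1%:R^-1)).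
  apply: cvgM; last exact: mul_zeta1_expN_cvg0.
  by apply: cvgM; [exact: monomial_cvg|exact: cvg_cst].
rewrite -[X in _ --> X](mul0r (zeta_series [:: b.+2] 1)).
apply: cvgM; last exact: zeta_expN_cvg.
by have := @monomial_cvg R (j - a).+1; rewrite monomial0.
Qed.

Lemma polynomial_part_cvg0 j m :
  polynomial_part j m t @[t --> (0:R)^'+] -->
    (-1) ^+ m * 'C(m + j, m)%:R * zeta_series [:: (m + j).+1] (1:R).
Proof.
have -> : (-1) ^+ m * 'C(m + j, m)%:R * zeta_series [:: (m + j).+1] (1:R) =
    polynomial_part j m 0.
  rewrite /polynomial_part big_ord_recr /= subnn monomial0 mulr1 big1 ?add0r // => i _.
  by rewrite monomial0 subn_eq0 leqNgt ltn_ord mulr0.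
apply: cvg_at_right_filter.
exact: is_derive_continuous (is_derive_polynomial_part j m 0).
Qed.

(** Here [j] counts the ones before the [2], so it is one less than the [j] of the theorem. In the
    induction on [m], differentiating either side lowers [m]; for [m = 0] both derivatives are
    [t^(j+1) / (j+1)!] over [sinh t]. *)
Lemma zeta_tanh_expansion j m t : 0 < t ->
  zeta_series (nseq m 1%N ++ 2%N :: nseq j 1%N) (tanh (t / 2)) =
  polynomial_part j.+1 m t + (-1) ^+ m.+1 * decaying_part j.+1 m t.
Proof.
pose E m t := polynomial_part j.+1 m t + (-1) ^+ m.+1 * decaying_part j.+1 m t.
have dE m0 u : 0 < u -> is_derive u (1 : R) (E m0)
    (if m0 is m'.+1 then E m' u else monomial j.+1 u / sinh u).
  move=> u0; apply: is_derive_eq (is_derive_add (is_derive_polynomial_part j.+1 m0 u)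
    (is_derive_scale _ (is_derive_decaying_part j.+1 m0 u0))) _.
  case: m0 => [|m0]; first by rewrite expr1 mulrNN mul1r add0r.
  by rewrite [in LHS]exprS mulN1r mulrNN.
(* The constants that survive in the two parts at [0+] agree up to opposite signs. *)
have E0 m0 : E m0 t @[t --> (0:R)^'+] --> (0:R).
  rewrite [X in _ --> X](_ : 0 = (-1) ^+ m0 * 'C(m0 + j.+1, m0)%:R *
      zeta_series [:: (m0 + j.+1).+1] (1:R) +
     (-1) ^+ m0.+1 * ('C(j.+1 + m0, m0)%:R * zeta_series [:: (j.+1 + m0).+1] (1:R))); last first.
    by rewrite [(j.+1 + m0)%N]addnC exprS; ring.
  have h1 := @polynomial_part_cvg0 j.+1 m0.
  have h2 : (-1) ^+ m0.+1 * decaying_part j.+1 m0 t @[t --> (0:R)^'+] -->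
      (-1) ^+ m0.+1 * ('C(j.+1 + m0, m0)%:R * zeta_series [:: (j.+1 + m0).+1] (1:R)).
    exact: cvgMl_tmp (@decaying_part_cvg0 j m0).
  exact: cvgD h1 h2.
elim: m t => [|m IH].
  have D u : 0 < u ->
      is_derive u (1 : R) (fun u => zeta_series (2%N :: nseq j 1%N) (tanh (u / 2)))
        (monomial j.+1 u / sinh u).
    by move=> u0; rewrite -zeta_tanh_nseq1 //; exact: is_derive_zeta_tanhSS.
  exact: (eq_derive_eq D (dE 0%N) (@zeta_tanh_cvg0 R _ _) (E0 0%N)).
have D u : 0 < u -> is_derive u (1 : R)
    (fun u => zeta_series (nseq m.+1 1%N ++ 2%N :: nseq j 1%N) (tanh (u / 2))) (E m u).
  by move=> u0; rewrite /E -IH //; exact: is_derive_zeta_tanh1.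
exact: (eq_derive_eq D (dE m.+1) (@zeta_tanh_cvg0 R _ _) (E0 m.+1)).
Qed.

End Expansion.

(** * Integrals over the half-line *)

Section HalfLine.
Local Open Scope classical_set_scope.
Local Open Scope ring_scope.
Variable R : realType.
Implicit Types (f g F G : R -> R) (x t c M a b : R) (n : nat).
Local Notation mu := (@lebesgue_measure R).
Local Notation D := (`]0, +oo[%classic : set R).

Definition integrable0y f := mu.-integrable D (EFin \o f).

Let D_gt0 x : D x -> 0 < x.
Proof. by rewrite /= in_itv /= andbT. Qed.

Let mD : measurable D.
Proof. exact: measurable_itv. Qed.

Lemma continuous_measurable0y f :
  (forall x, 0 < x -> {for x, continuous f}) -> measurable_fun D f.
Proof.
move=> cf; apply: subspace_continuous_measurable_fun => //.
by apply: continuous_in_subspaceT => x /[!inE] /D_gt0; exact: cf.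
Qed.

Lemma integrable0y_le f g : measurable_fun D f -> integrable0y g ->
  (forall x, 0 < x -> `|f x| <= g x) -> integrable0y f.
Proof.
move=> mf ig fg; apply: le_integrable ig => //; first exact/measurable_EFinP.
move=> x /D_gt0 x0 /=; rewrite lee_fin; apply: le_trans (fg x x0) _.
exact: ler_norm.
Qed.

Lemma integrable0yZ c f : integrable0y f -> integrable0y (fun t => c * f t).
Proof.
move=> fi; have := @integrableZl _ _ R mu D mD c _ fi; apply: eq_integrable => // x _ /=.
Qed.

Lemma integrable0yD f g : integrable0y f -> integrable0y g ->
  integrable0y (fun t => f t + g t).
Proof.
move=> fi gi; have := @integrableD _ _ R mu D mD _ _ fi gi; apply: eq_integrable => // x _ /=.
Qed.

Lemma eq_integrable0y f g : (forall x, 0 < x -> f x = g x) ->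
  integrable0y f -> integrable0y g.
Proof.
by move=> fg; apply: eq_integrable => // x /[!inE] /D_gt0 x0 /=; rewrite fg.
Qed.

Lemma eq_Rintegral0y f g : (forall x, 0 < x -> f x = g x) ->
  Rintegral mu D f = Rintegral mu D g.
Proof. by move=> fg; apply: eq_Rintegral => x /[!inE] /D_gt0; exact: fg. Qed.

Lemma Rintegral0yZ c f : integrable0y f ->
  Rintegral mu D (fun t => c * f t) = c * Rintegral mu D f.
Proof. by move=> fi; rewrite RintegralZl. Qed.

Lemma Rintegral0yD f g : integrable0y f -> integrable0y g ->
  Rintegral mu D (fun t => f t + g t) = Rintegral mu D f + Rintegral mu D g.
Proof. by move=> fi gi; rewrite RintegralD. Qed.

Lemma ler_Rintegral0y f g : integrable0y f -> integrable0y g ->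
  (forall x, 0 < x -> f x <= g x) -> Rintegral mu D f <= Rintegral mu D g.
Proof. by move=> fi gi fg; apply: le_Rintegral => // x /D_gt0; exact: fg. Qed.

(** Comparison with [c] times the indicator of [[1, 2]], whose integral is [c]. *)
Lemma Rintegral0y_gt0 f c : integrable0y f -> 0 < c ->
  (forall x, 0 < x -> 0 <= f x) -> (forall x, 1 <= x <= 2 -> c <= f x) ->
  0 < Rintegral mu D f.
Proof.
move=> fi c0 f0 fc; apply: (lt_le_trans c0).
pose J : set R := `[1, 2]%classic.
have mJ : measurable J by exact: measurable_itv.
have JD : J `<=` D.
  by move=> x; rewrite /J /= !in_itv /= andbT => /andP[h _]; exact: lt_le_trans h.
have fm : measurable_fun D f by apply/measurable_EFinP; case/integrableP: fi.
have -> : c = Rintegral mu D (cst c \_ J).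
  rewrite -Rintegral_mkcondr (setIidr JD) Rintegral_cst //.
  have muJ : (mu J = 1%:E)%E.
    rewrite /J lebesgue_measure_itv /= lte_fin ltr1n /= -EFinB; congr EFin; lra.
  by move: muJ => /= ->; rewrite mulr1.
apply: ler_Rintegral0y => //.
- apply: (integrable0y_le _ fi).
    by apply/(measurable_restrict _ mJ mD); exact: measurable_cst.
  move=> x x0; rewrite /patch; case: ifP => [|_]; last by rewrite normr0 f0.
  rewrite inE /J /= in_itv /= => xJ.
  by rewrite gtr0_norm // fc.
- move=> x x0; rewrite /patch; case: ifP => [|_]; last by rewrite f0.
  by rewrite inE /J /= in_itv /= => xJ; rewrite fc.
Qed.

Lemma dominated_cvg0y (f_ : nat -> R -> R) f g :
  (forall n, measurable_fun D (f_ n)) ->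
  (forall x, 0 < x -> f_ n x @[n --> \oo] --> f x) ->
  integrable0y g -> (forall n x, 0 < x -> `|f_ n x| <= g x) ->
  integrable0y f /\
  Rintegral mu D (f_ n) @[n --> \oo] --> Rintegral mu D f.
Proof.
move=> mf_ cf ig fg.
have cfE x : D x -> (fun n => (f_ n x)%:E) @ \oo --> (f x)%:E.
  by move=> /D_gt0 x0; apply: cvg_EFin (cf x x0); apply: nearW.
have mf_E n : measurable_fun D (EFin \o f_ n) by exact/measurable_EFinP.
have mfE : measurable_fun D (EFin \o f).
  exact: (emeasurable_fun_cvg _ _ mf_E cfE).
have [||i _ c] := @dominated_convergence _ _ R mu D mD (fun n => EFin \o f_ n)
  (EFin \o f) (EFin \o g) mf_E mfE _ ig _.
- by apply: aeW => x Dx; exact: cfE.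
- by apply: aeW => x n /D_gt0 x0; rewrite lee_fin fg.
split=> //; apply: fine_cvg.
by rewrite /Rintegral fineK //; exact: integrable_fin_num.
Qed.

(** Compact intervals inside the half-line, on which the fundamental theorem and substitution are
    available. The dilation [t -> c t] carries [exhaustion 1 n] onto [exhaustion c n]. *)
Definition exhaustion c n : set R := `[c / n.+1%:R, c * n.+1%:R]%classic.

Lemma exhaustion_sub c n : 0 < c -> exhaustion c n `<=` D.
Proof.
move=> c0 x; rewrite /exhaustion /= !in_itv /= andbT => /andP[+ _].
by apply: lt_le_trans; rewrite divr_gt0.
Qed.

Lemma exhaustion_near c x : 0 < c -> 0 < x -> \forall n \near \oo, exhaustion c n x.
Proof.
move=> c0 x0; near=> n; rewrite /exhaustion /= in_itv /=.
have nS : n%:R <= n.+1%:R :> R by rewrite ler_nat.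
have h1 : c / x <= n.+1%:R.
  by apply: le_trans nS; near: n; exact: nbhs_infty_ger.
have h2 : x / c <= n.+1%:R.
  by apply: le_trans nS; near: n; exact: nbhs_infty_ger.
rewrite ler_pdivrMr // mulrC -ler_pdivrMr // h1 /=.
by rewrite mulrC -ler_pdivrMr.
Unshelve. all: by end_near. Qed.

Lemma exhaustion_nondecreasing c : 0 < c -> nondecreasing_seq (exhaustion c).
Proof.
move=> c0; apply/nondecreasing_seqP => n; rewrite subsetEset => x.
rewrite /exhaustion /= !in_itv /= => /andP[h1 h2]; apply/andP; split.
  by apply: le_trans h1; rewrite ler_pM2l // lef_pV2 ?posrE // ler_nat.
by apply: le_trans h2 _; rewrite ler_pM2l // ler_nat.
Qed.

Lemma exhaustion_bigcup c : 0 < c -> \bigcup_n exhaustion c n = D.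
Proof.
move=> c0; apply/seteqP; split=> [x [n _]|x /D_gt0 x0].
  exact: exhaustion_sub.
have [N _ /(_ N (leqnn N)) h] := exhaustion_near c0 x0.
by exists N.
Qed.

Lemma cvg_Rintegral_exhaustion f c : 0 < c -> integrable0y f ->
  Rintegral mu (exhaustion c n) f @[n --> \oo] --> Rintegral mu D f.
Proof.
move=> c0 fi.
have mE n : measurable (exhaustion c n) by exact: measurable_itv.
have -> : (fun n => Rintegral mu (exhaustion c n) f) =
    (fun n => Rintegral mu D (f \_ (exhaustion c n))).
  apply/funext => n; rewrite -Rintegral_mkcondr; congr Rintegral.
  by apply/esym/setIidr; exact: exhaustion_sub.
have fm : measurable_fun D f by apply/measurable_EFinP; case/integrableP: fi.
have [||||_ //] := @dominated_cvg0y (fun n => f \_ (exhaustion c n)) f (fun x => `|f x|) _ _ _ _.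
- move=> n; apply/(measurable_restrict f (mE n) mD).
  by apply: measurable_funS fm => // x [].
- move=> x x0; apply: cvg_near_cst.
  near=> n; rewrite /patch ifT // inE; near: n; exact: exhaustion_near.
- exact: integrable_norm.
- by move=> n x x0; rewrite /patch; case: ifP; rewrite ?normr0.
Unshelve. all: by end_near. Qed.

Lemma integral_exhaustion_FTC f F n :
  (forall x, 0 < x -> is_derive x (1 : R) F (f x)) ->
  (forall x, 0 < x -> {for x, continuous f}) ->
  (\int[mu]_(x in exhaustion 1 n) (f x)%:E = (F n.+1%:R - F n.+1%:R^-1)%:E)%E.
Proof.
move=> dF cf; rewrite /exhaustion div1r mul1r.
(* For [n = 0] the interval is the single point [1], while the fundamental theorem below asks for
   distinct endpoints. *)
have := leq0n n; rewrite leq_eqVlt => /predU1P[<-|n0].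
  by rewrite invr1 set_itv1 integral_set1 subrr.
have i0 : 0 < n.+1%:R^-1 :> R by rewrite invr_gt0.
have ii : n.+1%:R^-1 < n.+1%:R :> R.
  apply: (@lt_trans _ _ 1); last by rewrite ltr1n.
  by rewrite invf_lt1 ?ltr1n.
have cF x : 0 < x -> {for x, continuous F}.
  by move=> x0; exact: is_derive_continuous (dF x x0).
rewrite (continuous_FTC2 ii (f := f) (F := F)) //.
- apply: continuous_in_subspaceT => x /[!inE] /=; rewrite in_itv /= => /andP[h _].
  by apply: cf; exact: lt_le_trans h.
- split.
  + move=> x; rewrite in_itv /= => /andP[h _].
    by have [] := dF x (lt_trans i0 h).
  + by apply: cvg_at_right_filter; exact: cF.
  + by apply: cvg_at_left_filter; apply: cF.
- move=> x; rewrite in_itv /= => /andP[h _].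
  by have dd := dF x (lt_trans i0 h); rewrite derive1E derive_val.
Qed.

Lemma Rintegral0y_FTC f F a b :
  (forall x, 0 < x -> is_derive x (1 : R) F (f x)) ->
  (forall x, 0 < x -> {for x, continuous f}) -> integrable0y f ->
  F n.+1%:R^-1 @[n --> \oo] --> a -> F n.+1%:R @[n --> \oo] --> b ->
  Rintegral mu D f = b - a.
Proof.
move=> dF cf fi Fa Fb.
have := cvg_Rintegral_exhaustion ltr01 fi.
under eq_fun do rewrite /Rintegral integral_exhaustion_FTC //=.
move=> /(cvg_unique (@norm_hausdorff _ _)); apply.
exact: cvgB.
Qed.

(** The integrals over the exhaustion are differences of values of [F], hence at most [M]; monotone
    convergence then bounds the whole integral. *)
Lemma ge0_integrable0y_FTC f F M :
  (forall x, 0 < x -> is_derive x (1 : R) F (f x)) ->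
  (forall x, 0 < x -> {for x, continuous f}) ->
  (forall x, 0 < x -> 0 <= f x) ->
  (forall x, 0 < x -> 0 <= F x <= M) -> integrable0y f.
Proof.
move=> dF cf f0 FM.
have fm := continuous_measurable0y cf.
apply/integrableP; split; first exact/measurable_EFinP.
have -> : (\int[mu]_(x in D) `|(EFin \o f) x| = \int[mu]_(x in D) (f x)%:E)%E.
  by apply: eq_integral => x /[!inE] /D_gt0 x0 /=; rewrite ger0_norm // f0.
have mE n : measurable (exhaustion 1 n : set R) by exact: measurable_itv.
have h : (\int[mu]_(x in exhaustion 1 n) (f x)%:E @[n --> \oo] -->
    \int[mu]_(x in \bigcup_n exhaustion 1 n) (f x)%:E)%E.
  apply: ge0_nondecreasing_set_cvg_integral => //.
  - exact: exhaustion_nondecreasing.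
  - move=> i; apply/measurable_EFinP; apply: measurable_funS fm => //.
    exact: exhaustion_sub.
  - by move=> i x /(exhaustion_sub ltr01) /D_gt0 x0 /=; rewrite lee_fin f0.
rewrite exhaustion_bigcup // in h.
apply: (@le_lt_trans _ _ M%:E); last exact: ltry.
apply: (cvge_le _ h).
apply: nearW => n /=; rewrite integral_exhaustion_FTC // lee_fin.
have /andP[_ h1] := FM n.+1%:R (ltr0Sn _ _).
have /andP[h2 _] : 0 <= F n.+1%:R^-1 <= M by apply: FM; rewrite invr_gt0.
by rewrite lerBlDr; apply: le_trans h1 _; rewrite lerDl.
Qed.

(** Substitution on each compact interval of the exhaustion, then the limit on both sides. *)
Lemma Rintegral0y_scale G c : 0 < c ->
  (forall x, 0 < x -> {for x, continuous G}) ->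
  integrable0y G -> integrable0y (fun t => c * G (c * t)) ->
  Rintegral mu D (fun t => c * G (c * t)) = Rintegral mu D G.
Proof.
move=> c0 cG iG iH.
have c1 := cvg_Rintegral_exhaustion c0 iG.
have := cvg_Rintegral_exhaustion ltr01 iH.
have -> : (fun n => Rintegral mu (exhaustion 1 n) (fun t => c * G (c * t))) =
  (fun n => Rintegral mu (exhaustion c n) G).
  apply/funext => n; rewrite /Rintegral; congr fine.
  have D1 x : is_derive x (1 : R) (fun x => c * x) c.
    apply: is_derive_eq (is_derive_scale c (is_derive_var x)) _; exact: mulr1.
  have D2 : derive1 (fun x => c * x) = (fun=> c).
    by apply/funext => x; have dd := D1 x; rewrite derive1E derive_val.
  have cx x : {for x, continuous (fun x => c * x)} by exact: is_derive_continuous (D1 x).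
  pose a : R := 1 / n.+1%:R; pose b : R := 1 * n.+1%:R.
  have a0 : 0 < a by rewrite divr_gt0.
  have -> : exhaustion c n = `[c * a, c * b]%classic by rewrite /a /b !mul1r.
  rewrite -[exhaustion 1 n]/(`[a, b]%classic : set R).
  have ab : a <= b.
    rewrite /a /b !mul1r; apply: (@le_trans _ _ 1); last by rewrite ler1n.
    by rewrite invf_le1 // ler1n.
  rewrite (@integration_by_substitution_increasing _ (fun x => c * x) G a b ab).
  - by apply: eq_integral => x _; rewrite D2 /= mulrC.
  - by move=> x y _ _ xy; rewrite ltr_pM2l.
  - by rewrite D2 => x _; exact: cst_continuous.
  - by rewrite D2; apply/cvg_ex; eexists; exact: cvg_cst.
  - by rewrite D2; apply/cvg_ex; eexists; exact: cvg_cst.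
  - split.
    + by move=> x _; have [] := D1 x.
    + by apply: cvg_at_right_filter; exact: cx.
    + by apply: cvg_at_left_filter; exact: cx.
  - apply: continuous_in_subspaceT => x /[!inE] /=; rewrite in_itv /= => /andP[h _].
    by apply: cG; apply: lt_le_trans h; rewrite mulr_gt0.
by move=> /(cvg_unique (@norm_hausdorff _ _)); apply.
Qed.

End HalfLine.

(** * Real powers *)

Section RealPower.
Local Open Scope classical_set_scope.
Local Open Scope ring_scope.
Variable R : realType.
Implicit Types (f df g F : R -> R) (x y t u a b c : R).

(** Integrating [cos <= 1] twice from [0] gives first [sin x <= x], then the claim; evenness reduces
    to [x >= 0]. *)
Lemma cos_ge1B x : 1 - x ^+ 2 / 2 <= cos x.
Proof.
wlog x0 : x / 0 <= x.
  move=> H; have [|/ltW xn] := leP 0 x; first exact: H.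
  by rewrite -cosN -sqrrN; apply: H; rewrite oppr_ge0.
have sinle y : 0 <= y -> 0 <= y - sin y.
  have D u : is_derive u (1 : R) (fun y => y - sin y) (1 - cos u).
    exact: is_derive_add (is_derive_var u) (is_derive_opp (is_derive_sin u)).
  apply: (ge0_derive_ge0 D); first by rewrite sin0 subrr.
  by move=> u _; rewrite subr_ge0 cos_le1.
have D u : is_derive u (1 : R) (fun x => cos x - (1 - x ^+ 2 / 2)) (u - sin u).
  have Dm := is_derive_monomial 2 u.
  apply: is_derive_eq (is_derive_add (is_derive_cos u) (is_derive_opp
    (is_derive_add (is_derive_const (1 : R) u) (is_derive_opp Dm)))) _.
  by rewrite /monomial expr1 divr1; ring.
have : 0 <= cos x - (1 - x ^+ 2 / 2).
  apply: (ge0_derive_ge0 D) => //.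
    by rewrite cos0 expr0n mul0r subr0 subrr.
  by move=> u u0; apply: sinle; exact: ltW.
by rewrite subr_ge0.
Qed.

(** With [w = |ln t| / 2] the right side is [4 sinh(w)^2], and [w <= sinh w]. The bound involves
    only integer powers of [t], so it integrates to shifted Gamma values. *)
Lemma sqr_ln_le t : 0 < t -> ln t ^+ 2 <= t - 2 + t^-1.
Proof.
move=> t0; pose w := `|ln t| / 2.
have w0 : 0 <= w by rewrite divr_ge0.
have h := sinh_ge w0.
have : w ^+ 2 <= sinh w ^+ 2 by rewrite ler_sqr ?nnegrE //; exact: le_trans h.
have -> : w ^+ 2 = ln t ^+ 2 / 4.
  by rewrite /w expr_div_n real_normK ?num_real //; congr (_ / _); ring.
have e2 : expR w * expR w = expR `|ln t| by rewrite -expRD /w -splitr.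
rewrite /sinh expRN; set y := expR w in e2 *.
have y0 : 0 < y by exact: expR_gt0.
have -> : ((y - y^-1) / 2) ^+ 2 = (y * y - 2 + (y * y)^-1) / 4.
  by field; rewrite gt_eqF.
rewrite e2.
have -> : expR `|ln t| - 2 + (expR `|ln t|)^-1 = t - 2 + t^-1.
  case: (ger0P (ln t)) => _; first by rewrite lnK.
  by rewrite expRN invrK lnK //; ring.
by lra.
Qed.

(** The modulus of [cpow t s] for [Re s = a]. *)
Definition rpow a t := expR (a * ln t).

Lemma rpow_gt0 a t : 0 < rpow a t. Proof. exact: expR_gt0. Qed.

Lemma rpowD a b t : rpow (a + b) t = rpow a t * rpow b t.
Proof. by rewrite /rpow mulrDl expRD. Qed.

Lemma rpow1 t : 0 < t -> rpow 1 t = t.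
Proof. by move=> t0; rewrite /rpow mul1r lnK. Qed.

Lemma rpowN1 t : 0 < t -> rpow (-1) t = t^-1.
Proof. by move=> t0; rewrite /rpow mulN1r expRN lnK. Qed.

Lemma rpowB1 a t : 0 < t -> rpow (a - 1) t = rpow a t / t.
Proof. by move=> t0; rewrite rpowD rpowN1. Qed.

Lemma rpow_nat n t : 0 < t -> rpow n%:R t = t ^+ n.
Proof. by move=> t0; rewrite /rpow mulr_natl -lnXn // lnK // posrE exprn_gt0. Qed.

Lemma is_derive_rpow a t : 0 < t -> is_derive t (1 : R) (rpow a) (a * rpow (a - 1) t).
Proof.
move=> t0; apply: is_derive_eq (is_derive_comp (g := fun u => a * ln u)
   (is_derive_expR (a * ln t)) (is_derive_scale a (is_derive1_ln t0))) _.
by rewrite rpowB1 // /rpow; ring.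
Qed.

(** Follows from [ln u <= u] at [u = t / a]. *)
Lemma rpow_le_expR a t : 0 < a -> 0 < t -> rpow a t <= rpow a a * expR t.
Proof.
move=> a0 t0; rewrite /rpow -expRD ler_expR.
have : ln (t / a) <= t / a by rewrite ltW // ln_sublinear // divr_gt0.
rewrite ln_div ?posrE // lerBlDr => h.
rewrite -[X in _ + X](_ : a * (t / a) = _); last by rewrite mulrC divfK ?gt_eqF.
by rewrite -mulrDr addrC ler_pM2l.
Qed.

Lemma rpow_le_id a t : 1 <= a -> 0 < t -> t <= 1 -> rpow a t <= t.
Proof.
move=> a1 t0 t1; rewrite -{2}(rpow1 t0) /rpow ler_expR ler_wnM2r // ln_le0 //.
Qed.

(** The majorant [h] is chosen for its explicit primitive [F], which is [(t / (1 + t))^a / a] and so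
    lies between [0] and [1 / a]. *)
Lemma integrable_rpow_expRN a : 0 < a ->
  integrable0y (fun t => rpow (a - 1) t * expR (- t)).
Proof.
move=> a0; pose h t := rpow (a - 1) t * rpow (- (a + 1)) (1 + t).
pose F t := a^-1 * (rpow a t * rpow (- a) (1 + t)).
have D1 t : is_derive t (1 : R) (fun u => 1 + u) 1.
  apply: is_derive_eq (is_derive_add (is_derive_const (1:R) t) (is_derive_var t)) _.
  by rewrite add0r.
have DF t : 0 < t -> is_derive t (1 : R) F (h t).
  move=> t0; have t1 : 0 < 1 + t by lra.
  apply: is_derive_eq (is_derive_scale _ (is_derive_mul (is_derive_rpow a t0)
    (is_derive_comp (g := fun u => 1 + u) (is_derive_rpow (- a) t1) (D1 t)))) _.
  rewrite /h opprD !rpowB1 //; field.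
  by rewrite !gt_eqF.
have ch t : 0 < t -> {for t, continuous h}.
  move=> t0; have t1 : 0 < 1 + t by lra.
  exact: is_derive_continuous (is_derive_mul (is_derive_rpow (a - 1) t0)
    (is_derive_comp (g := fun u => 1 + u) (is_derive_rpow (- (a + 1)) t1) (D1 t))).
have ih : integrable0y h.
  apply: (@ge0_integrable0y_FTC _ h F a^-1) => // t t0.
    by rewrite mulr_ge0 // ltW // rpow_gt0.
  rewrite /F mulr_ge0 ?invr_ge0 ?mulr_ge0 ?(ltW a0) ?(ltW (rpow_gt0 _ _)) //=.
  rewrite ger_pMr ?invr_gt0 // /rpow -expRD -[leRHS]expR0 ler_expR mulNr subr_le0.
  by rewrite ler_pM2l // ler_ln ?posrE //; lra.
(* From [(1+t)^(a+1) <= (a+1)^(a+1) e^(1+t)] one gets [e^(-t) <= C (1+t)^(-(a+1))]. *)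
pose C := rpow (a + 1) (a + 1) * expR 1.
have iC : integrable0y (fun t => C * h t).
  exact: integrable0yZ.
apply: (integrable0y_le _ iC).
  apply: continuous_measurable0y => t t0.
  exact: is_derive_continuous (is_derive_mul (is_derive_rpow (a - 1) t0) (is_derive_expN t)).
move=> t t0; have t1 : 0 < 1 + t by lra.
rewrite ger0_norm; last by rewrite mulr_ge0 // ?expR_ge0 // ltW // rpow_gt0.
rewrite /h mulrCA ler_pM2l ?rpow_gt0 //.
have a1 : 0 < a + 1 by lra.
have := rpow_le_expR a1 t1; rewrite expRD mulrA -/C expRN => k.
have -> : rpow (- (a + 1)) (1 + t) = (rpow (a + 1) (1 + t))^-1.
  by rewrite /rpow mulNr expRN.
by rewrite ler_pdivlMr ?rpow_gt0 // mulrC ler_pdivrMr ?expR_gt0.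
Qed.

End RealPower.

(** * The Gamma function *)

Section GammaFunction.
Local Open Scope classical_set_scope.
Local Open Scope ring_scope.
Variable R : realType.
Implicit Types (f df g F : R -> R) (x y t u a b c : R).
Local Notation mu := (@lebesgue_measure R).
Local Notation D := (`]0, +oo[%classic : set R).

Lemma continuous_add f g t : {for t, continuous f} -> {for t, continuous g} ->
  {for t, continuous (fun u => f u + g u)}.
Proof. by move=> cf cg; exact: cvgD cf cg. Qed.

Lemma continuous_mul f g t : {for t, continuous f} -> {for t, continuous g} ->
  {for t, continuous (fun u => f u * g u)}.
Proof. by move=> cf cg; exact: cvgM cf cg. Qed.

Lemma continuous_scale c f t : {for t, continuous f} ->
  {for t, continuous (fun u => c * f u)}.
Proof. by move=> cf; exact: cvgMl_tmp cf. Qed.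

(** This and [rpow_sin] are the real and imaginary parts of [t^(a + i b)]. *)
Definition rpow_cos a b t := rpow a t * cos (b * ln t).
Definition rpow_sin a b t := rpow a t * sin (b * ln t).

Lemma is_derive_mul_ln b t : 0 < t -> is_derive t (1 : R) (fun u => b * ln u) (b / t).
Proof. by move=> t0; exact: is_derive_scale (is_derive1_ln t0). Qed.

Lemma is_derive_rpow_cos a b t : 0 < t -> is_derive t (1 : R) (rpow_cos a b)
  (a * rpow_cos (a - 1) b t - b * rpow_sin (a - 1) b t).
Proof.
move=> t0; apply: is_derive_eq (is_derive_mul (is_derive_rpow a t0)
  (is_derive_comp (g := fun u => b * ln u) (is_derive_cos _) (is_derive_mul_ln b t0))) _.
by rewrite /rpow_cos /rpow_sin rpowB1 //; field; rewrite gt_eqF.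
Qed.

Lemma is_derive_rpow_sin a b t : 0 < t -> is_derive t (1 : R) (rpow_sin a b)
  (a * rpow_sin (a - 1) b t + b * rpow_cos (a - 1) b t).
Proof.
move=> t0; apply: is_derive_eq (is_derive_mul (is_derive_rpow a t0)
  (is_derive_comp (g := fun u => b * ln u) (is_derive_sin _) (is_derive_mul_ln b t0))) _.
by rewrite /rpow_cos /rpow_sin rpowB1 //; field; rewrite gt_eqF.
Qed.

Lemma continuous_rpow_cos a b t : 0 < t -> {for t, continuous (rpow_cos a b)}.
Proof. by move=> t0; exact: is_derive_continuous (is_derive_rpow_cos a b t0). Qed.

Lemma continuous_rpow_sin a b t : 0 < t -> {for t, continuous (rpow_sin a b)}.
Proof. by move=> t0; exact: is_derive_continuous (is_derive_rpow_sin a b t0). Qed.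

Lemma continuous_expRN t : {for t, continuous (fun t => expR (- t))}.
Proof. exact: is_derive_continuous (is_derive_expN t). Qed.

Lemma norm_rpow_cos_le a b t : `|rpow_cos a b t| <= rpow a t.
Proof.
rewrite normrM gtr0_norm ?rpow_gt0 // ler_piMr ?cos_max //.
exact: ltW (rpow_gt0 _ _).
Qed.

Lemma norm_rpow_sin_le a b t : `|rpow_sin a b t| <= rpow a t.
Proof.
rewrite normrM gtr0_norm ?rpow_gt0 // ler_piMr ?sin_max //.
exact: ltW (rpow_gt0 _ _).
Qed.

(** Absolute convergence of the Mellin integral on the whole line of real part [a], since both
    kernels are bounded by [rpow (a - 1)]. *)
Definition mellin_integrable g a :=
  measurable_fun D g /\ integrable0y (fun t => rpow (a - 1) t * `|g t|).

Lemma mellin_integrable_cos g a b : mellin_integrable g a ->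
  integrable0y (fun t => rpow_cos (a - 1) b t * g t).
Proof.
move=> [mg ig]; apply: (integrable0y_le _ ig).
  apply: measurable_funM => //.
  by apply: continuous_measurable0y => t; exact: continuous_rpow_cos.
by move=> t t0; rewrite normrM ler_wpM2r // norm_rpow_cos_le.
Qed.

Lemma mellin_integrable_sin g a b : mellin_integrable g a ->
  integrable0y (fun t => rpow_sin (a - 1) b t * g t).
Proof.
move=> [mg ig]; apply: (integrable0y_le _ ig).
  apply: measurable_funM => //.
  by apply: continuous_measurable0y => t; exact: continuous_rpow_sin.
by move=> t t0; rewrite normrM ler_wpM2r // norm_rpow_sin_le.
Qed.

Lemma mellin_integrable_expRN a : 0 < a -> mellin_integrable (fun t => expR (- t)) a.
Proof.
move=> a0; split.
  by apply: continuous_measurable0y => t _; exact: continuous_expRN.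
apply: eq_integrable0y (integrable_rpow_expRN a0) => t t0.
by rewrite ger0_norm // expR_ge0.
Qed.

Lemma rpow_expRN_boundary F a : 1 < a ->
  (forall t, 0 < t -> `|F t| <= rpow a t * expR (- t)) ->
  F n.+1%:R^-1 @[n --> \oo] --> (0 : R) /\ F n.+1%:R @[n --> \oo] --> (0 : R).
Proof.
move=> a1 FE; have a0 : 0 < a + 1 by lra.
pose C := rpow (a + 1) (a + 1).
have C0 : 0 <= C by rewrite ltW // rpow_gt0.
have h1 n : `|F n.+1%:R^-1| <= n.+1%:R^-1.
  have t0 : 0 < n.+1%:R^-1 :> R by rewrite invr_gt0.
  apply: le_trans (FE _ t0) _; rewrite -[leRHS]mulr1 ler_pM ?expR_ge0 //.
  by rewrite rpow_le_id ?(ltW a1) // invf_le1 // ler1n.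
have h2 n : `|F n.+1%:R| <= C * n.+1%:R^-1.
  have t0 : 0 < n.+1%:R :> R by [].
  apply: le_trans (FE _ t0) _.
  have := rpow_le_expR a0 t0; rewrite rpowD rpow1 // -/C.
  by rewrite expRN ler_pdivrMr ?expR_gt0 // mulrAC ler_pdivlMr.
have cn : n.+1%:R^-1 @[n --> \oo] --> (0 : R) by exact: cvg_harmonic.
split; apply/norm_cvg0P.
  by apply: (squeeze_cvgr _ (cvg_cst 0) cn); apply: nearW => n; rewrite normr_ge0 h1.
have cn2 : C * n.+1%:R^-1 @[n --> \oo] --> (0 : R).
  by rewrite -[X in _ --> X](mulr0 C); exact: cvgMl_tmp.
by apply: (squeeze_cvgr _ (cvg_cst 0) cn2); apply: nearW => n; rewrite normr_ge0 h2.
Qed.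

Definition gamma_cos a b := Rintegral mu D (fun t => rpow_cos (a - 1) b t * expR (- t)).
Definition gamma_sin a b := Rintegral mu D (fun t => rpow_sin (a - 1) b t * expR (- t)).

(** Real part of [Gamma (s + 1) = s Gamma s] for [s = a + i b]: the derivative [f] of
    [F = Re (t^s) e^(-t)] has integral [0]. *)
Lemma gamma_cos_succ a b : 1 < a ->
  gamma_cos (a + 1) b = a * gamma_cos a b - b * gamma_sin a b.
Proof.
move=> a1; have a0 : 0 < a by lra.
have a2 : 0 < a + 1 by lra.
have ic := mellin_integrable_cos b (mellin_integrable_expRN a0).
have isn := mellin_integrable_sin b (mellin_integrable_expRN a0).
have ic1 := mellin_integrable_cos b (mellin_integrable_expRN a2).
have e : gamma_cos (a + 1) b = Rintegral mu D (fun t => rpow_cos a b t * expR (- t)).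
  by rewrite /gamma_cos addrK.
rewrite addrK in ic1.
pose F t := rpow_cos a b t * expR (- t).
pose f t := a * (rpow_cos (a - 1) b t * expR (- t)) +
  (- b * (rpow_sin (a - 1) b t * expR (- t)) + -1 * (rpow_cos a b t * expR (- t))).
have j0 := integrable0yZ a ic.
have j1 := integrable0yZ (- b) isn.
have j2 := integrable0yZ (-1) ic1.
have j12 := integrable0yD j1 j2.
have FE t : 0 < t -> `|F t| <= rpow a t * expR (- t).
  by move=> _; rewrite normrM (ger0_norm (expR_ge0 _)) ler_wpM2r ?expR_ge0 // norm_rpow_cos_le.
have [h0 hy] := rpow_expRN_boundary a1 FE.
have DF t : 0 < t -> is_derive t (1 : R) F (f t).
  move=> t0.
  apply: is_derive_eq (is_derive_mul (is_derive_rpow_cos a b t0) (is_derive_expN t)) _.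
  by rewrite /f; ring.
have cf t : 0 < t -> {for t, continuous f}.
  move=> t0; have ce := @continuous_expRN t.
  have k1 := continuous_mul (@continuous_rpow_cos (a - 1) b t t0) ce.
  have k2 := continuous_mul (@continuous_rpow_sin (a - 1) b t t0) ce.
  have k3 := continuous_mul (@continuous_rpow_cos a b t t0) ce.
  refine (continuous_add (continuous_scale (c := a) k1)
    (continuous_add (continuous_scale (c := - b) k2) (continuous_scale (c := -1) k3))).
have := Rintegral0y_FTC DF cf (integrable0yD j0 j12) h0 hy.
rewrite (Rintegral0yD j0 j12) (Rintegral0yD j1 j2).
rewrite (Rintegral0yZ a ic) (Rintegral0yZ (- b) isn) (Rintegral0yZ (-1) ic1).
rewrite -e -/(gamma_cos a b) -/(gamma_sin a b) subrr.
set X := gamma_cos a b; set Y := gamma_sin a b; set Z := gamma_cos (a + 1) b.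
by clearbody X Y Z; lra.
Qed.

Lemma gamma_sin_succ a b : 1 < a ->
  gamma_sin (a + 1) b = a * gamma_sin a b + b * gamma_cos a b.
Proof.
move=> a1; have a0 : 0 < a by lra.
have a2 : 0 < a + 1 by lra.
have ic := mellin_integrable_cos b (mellin_integrable_expRN a0).
have isn := mellin_integrable_sin b (mellin_integrable_expRN a0).
have ic1 := mellin_integrable_sin b (mellin_integrable_expRN a2).
have e : gamma_sin (a + 1) b = Rintegral mu D (fun t => rpow_sin a b t * expR (- t)).
  by rewrite /gamma_sin addrK.
rewrite addrK in ic1.
pose F t := rpow_sin a b t * expR (- t).
pose f t := a * (rpow_sin (a - 1) b t * expR (- t)) +
  (b * (rpow_cos (a - 1) b t * expR (- t)) + -1 * (rpow_sin a b t * expR (- t))).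
have j0 := integrable0yZ a isn.
have j1 := integrable0yZ b ic.
have j2 := integrable0yZ (-1) ic1.
have j12 := integrable0yD j1 j2.
have FE t : 0 < t -> `|F t| <= rpow a t * expR (- t).
  by move=> _; rewrite normrM (ger0_norm (expR_ge0 _)) ler_wpM2r ?expR_ge0 // norm_rpow_sin_le.
have [h0 hy] := rpow_expRN_boundary a1 FE.
have DF t : 0 < t -> is_derive t (1 : R) F (f t).
  move=> t0.
  apply: is_derive_eq (is_derive_mul (is_derive_rpow_sin a b t0) (is_derive_expN t)) _.
  by rewrite /f; ring.
have cf t : 0 < t -> {for t, continuous f}.
  move=> t0; have ce := @continuous_expRN t.
  have k1 := continuous_mul (@continuous_rpow_sin (a - 1) b t t0) ce.
  have k2 := continuous_mul (@continuous_rpow_cos (a - 1) b t t0) ce.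
  have k3 := continuous_mul (@continuous_rpow_sin a b t t0) ce.
  refine (continuous_add (continuous_scale (c := a) k1)
    (continuous_add (continuous_scale (c := b) k2) (continuous_scale (c := -1) k3))).
have := Rintegral0y_FTC DF cf (integrable0yD j0 j12) h0 hy.
rewrite (Rintegral0yD j0 j12) (Rintegral0yD j1 j2).
rewrite (Rintegral0yZ a isn) (Rintegral0yZ b ic) (Rintegral0yZ (-1) ic1).
rewrite -e -/(gamma_cos a b) -/(gamma_sin a b) subrr.
set X := gamma_cos a b; set Y := gamma_sin a b; set Z := gamma_sin (a + 1) b.
by clearbody X Y Z; lra.
Qed.

Definition gamma_real a := Rintegral mu D (fun t => rpow (a - 1) t * expR (- t)).

Lemma gamma_realE a : gamma_real a = gamma_cos a 0.
Proof.
by apply: eq_Rintegral0y => t _; rewrite /rpow_cos mul0r cos0 mulr1.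
Qed.

Lemma gamma_real_succ a : 1 < a -> gamma_real (a + 1) = a * gamma_real a.
Proof. by move=> a1; rewrite !gamma_realE gamma_cos_succ // mul0r subr0. Qed.

Lemma gamma_real_gt0 a : 1 < a -> 0 < gamma_real a.
Proof.
move=> a1; apply: (@Rintegral0y_gt0 _ _ (expR (- 2))).
- by apply: integrable_rpow_expRN; lra.
- exact: expR_gt0.
- by move=> t _; rewrite mulr_ge0 ?expR_ge0 // ltW // rpow_gt0.
- move=> t /andP[t1 t2]; rewrite -[leLHS]mul1r ler_pM ?expR_ge0 //.
    rewrite /rpow -[leLHS]expR0 ler_expR mulr_ge0 ?ln_ge0 //; lra.
  by rewrite ler_expR lerN2.
Qed.

(* Rotating by the phase at the peak [t = a] of the integrand makes the real part
   close to the real Gamma function. *)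
Lemma gamma_phase_gt0 a b : 2 < a -> b ^+ 2 < 2 * (a - 1) ->
  0 < cos (b * ln a) * gamma_cos a b + sin (b * ln a) * gamma_sin a b.
Proof.
move=> a2 ba; have a0 : 0 < a by lra.
have ic := mellin_integrable_cos b (mellin_integrable_expRN a0).
have isn := mellin_integrable_sin b (mellin_integrable_expRN a0).
have k0 := integrable0yZ (cos (b * ln a)) ic.
have k1 := integrable0yZ (sin (b * ln a)) isn.
rewrite /gamma_cos /gamma_sin -(Rintegral0yZ _ ic) -(Rintegral0yZ _ isn) -(Rintegral0yD k0 k1).
have i0 := integrable_rpow_expRN a0.
have i1 : integrable0y (fun t => rpow (a + 1 - 1) t * expR (- t)).
  by apply: integrable_rpow_expRN; lra.
have i2 : integrable0y (fun t => rpow (a - 1 - 1) t * expR (- t)).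
  by apply: integrable_rpow_expRN; lra.
(* Coefficients of [1], [t] and [1 / t] in [1 - (b^2 / 2) (t / a - 2 + a / t)], the lower bound for
   [cos (b ln (t / a))] that [cos_ge1B] and [sqr_ln_le] give. *)
pose c0 := 1 + b ^+ 2; pose c1 := - (b ^+ 2 / (2 * a)); pose c2 := - (b ^+ 2 / 2 * a).
have j0 := integrable0yZ c0 i0.
have j1 := integrable0yZ c1 i1.
have j2 := integrable0yZ c2 i2.
have j12 := integrable0yD j1 j2.
pose f t := c0 * (rpow (a - 1) t * expR (- t)) +
  (c1 * (rpow (a + 1 - 1) t * expR (- t)) + c2 * (rpow (a - 1 - 1) t * expR (- t))).
have if0 : integrable0y f := integrable0yD j0 j12.
apply: (@lt_le_trans _ _ (Rintegral mu D f)).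
  rewrite (Rintegral0yD j0 j12) (Rintegral0yD j1 j2).
  rewrite (Rintegral0yZ c0 i0) (Rintegral0yZ c1 i1) (Rintegral0yZ c2 i2).
  rewrite -/(gamma_real a) -/(gamma_real (a + 1)) -/(gamma_real (a - 1)).
  rewrite gamma_real_succ; last by lra.
  have a1 : 1 < a - 1 by lra.
  have := gamma_real_succ a1; rewrite subrK => ->.
  have := gamma_real_gt0 a1; set G := gamma_real (a - 1); clearbody G => G0.
  (* After reduction to [G], the value at [a - 1], the terms in [a b^2] cancel, leaving [b^2]
     against [2 (a - 1)]. *)
  have -> : c0 * ((a - 1) * G) + (c1 * (a * ((a - 1) * G)) + c2 * G) =
    G / 2 * (2 * (a - 1) - b ^+ 2).
    by rewrite /c0 /c1 /c2; field; rewrite gt_eqF.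
  by rewrite mulr_gt0 ?divr_gt0 // subr_gt0.
apply: (ler_Rintegral0y if0 (integrable0yD k0 k1)).
move=> t t0; rewrite /rpow_cos /rpow_sin.
have -> : cos (b * ln a) * (rpow (a - 1) t * cos (b * ln t) * expR (- t)) +
  sin (b * ln a) * (rpow (a - 1) t * sin (b * ln t) * expR (- t)) =
  rpow (a - 1) t * expR (- t) * cos (b * ln (t / a)).
  by rewrite ln_div ?posrE // mulrBr cosB; ring.
have -> : f t = rpow (a - 1) t * expR (- t) *
   (1 - b ^+ 2 * (t / a - 2 + (t / a)^-1) / 2).
  rewrite /f [rpow (a - 1 - 1) t]rpowB1 // [rpow (a + 1 - 1) t]rpowB1 // [rpow (a + 1) t]rpowD.
  rewrite rpow1 // /c0 /c1 /c2 rpowB1 //; field; rewrite !gt_eqF //.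
rewrite ler_pM2l ?mulr_gt0 ?rpow_gt0 ?expR_gt0 //.
apply: le_trans (cos_ge1B _).
rewrite lerD2l lerN2 ler_pM2r ?invr_gt0 // exprMn.
by rewrite ler_wpM2l ?sqr_ge0 // sqr_ln_le // divr_gt0.
Qed.

End GammaFunction.

(** * Mellin transforms *)

Section Mellin.
Local Open Scope classical_set_scope.
Local Open Scope complex_scope.
Local Open Scope ring_scope.
Variable R : realType.
Local Notation C := (R[i]).
Implicit Types (f g : R -> R) (t x a b c : R) (s : C).
Local Notation mu := (@lebesgue_measure R).
Local Notation D := (`]0, +oo[%classic : set R).

Lemma complex_ext (x y : C) : complex.Re x = complex.Re y -> complex.Im x = complex.Im y -> x = y.
Proof. by case: x => a b; case: y => c d /= -> ->. Qed.

Lemma cpowD t s s' : cpow t (s + s') = cpow t s * cpow t s'.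
Proof.
case: s => a b; case: s' => c d; apply: complex_ext; rewrite /cpow /=.
  by rewrite !mulrDl expRD cosD; ring.
by rewrite !mulrDl expRD sinD; ring.
Qed.

Lemma cpow_nat n t : 0 < t -> cpow t n%:R = (t ^+ n)%:C.
Proof.
move=> t0; rewrite -(rmorph_nat (real_complex R) n).
apply: complex_ext; rewrite /cpow /= ?mul0r ?cos0 ?sin0; last by ring.
by rewrite -(rpow_nat n t0) /rpow; ring.
Qed.

Lemma cpow_neq0 t s : cpow t s != 0.
Proof.
suff : cpow t s * cpow t (- s) = 1.
  by move=> h; apply/eqP => h0; move: h; rewrite h0 mul0r => /eqP; rewrite eq_sym oner_eq0.
rewrite -cpowD subrr; apply: complex_ext; rewrite /cpow /= ?mul0r ?expR0 ?cos0 ?sin0; ring.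
Qed.

Definition mellin g s : C := integral0y (fun t => cpow t (s - 1) * (g t)%:C).

Lemma mellinE g s : mellin g s =
  Rintegral mu D (fun t => rpow_cos (complex.Re s - 1) (complex.Im s) t * g t) +i*
  Rintegral mu D (fun t => rpow_sin (complex.Re s - 1) (complex.Im s) t * g t).
Proof.
case: s => a b; rewrite /mellin /integral0y; congr Complex; apply: eq_Rintegral => t _.
  by rewrite /cpow /rpow_cos /rpow /= oppr0 addr0; ring.
by rewrite /cpow /rpow_sin /rpow /= oppr0 addr0; ring.
Qed.

Lemma eq_mellin f g s : (forall t, 0 < t -> f t = g t) -> mellin f s = mellin g s.
Proof.
by move=> fg; rewrite !mellinE; congr Complex; apply: eq_Rintegral0y => t t0; rewrite fg.
Qed.

Lemma measurable_rpow a : measurable_fun D (rpow a).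
Proof.
by apply: continuous_measurable0y => t t0; exact: is_derive_continuous (is_derive_rpow a t0).
Qed.

Lemma mellin_integrableD f g a : mellin_integrable f a -> mellin_integrable g a ->
  mellin_integrable (fun t => f t + g t) a.
Proof.
move=> [mf fi] [mg gi].
have mfg : measurable_fun D (fun t => f t + g t) by exact: measurable_funD.
split=> //; apply: (integrable0y_le _ (integrable0yD fi gi)).
  apply: measurable_funM; first exact: measurable_rpow.
  exact: measurableT_comp.
move=> t t0; rewrite normrM normr_id gtr0_norm ?rpow_gt0 // -mulrDr.
by rewrite ler_pM2l ?rpow_gt0 // ler_normD.
Qed.

Lemma mellin_integrableZ c g a : mellin_integrable g a ->
  mellin_integrable (fun t => c * g t) a.
Proof.
move=> [mg gi]; split; first by apply: measurable_funM.
apply: eq_integrable0y (integrable0yZ `|c| gi) => t t0.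
by rewrite normrM; ring.
Qed.

Lemma mellin_integrable_sum n (c : nat -> R) (g : nat -> R -> R) a :
  (forall i, (i < n)%N -> mellin_integrable (g i) a) ->
  mellin_integrable (fun t => \sum_(i < n) c i * g i t) a.
Proof.
elim: n => [|n IH] H.
  rewrite (_ : (fun t => _) = cst 0); last by apply/funext => t; rewrite big_ord0.
  split; first exact: measurable_cst.
  apply: (@eq_integrable0y _ (fun=> 0)); last exact: integrable0.
  by move=> t _; rewrite /cst normr0 mulr0.
rewrite (_ : (fun t => _) = (fun t => \sum_(i < n) c i * g i t + c n * g n t)); last first.
  by apply/funext => t; rewrite big_ord_recr.
apply: mellin_integrableD; last by apply: mellin_integrableZ; exact: H.
by apply: IH => i ni; apply: H; rewrite ltnW.
Qed.

Lemma mellinD f g s : mellin_integrable f (complex.Re s) -> mellin_integrable g (complex.Re s) ->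
  mellin (fun t => f t + g t) s = mellin f s + mellin g s.
Proof.
move=> fi gi; rewrite !mellinE; apply: complex_ext => /=.
  rewrite -(Rintegral0yD (mellin_integrable_cos _ fi) (mellin_integrable_cos _ gi)).
  by apply: eq_Rintegral0y => t t0; rewrite mulrDr.
rewrite -(Rintegral0yD (mellin_integrable_sin _ fi) (mellin_integrable_sin _ gi)).
by apply: eq_Rintegral0y => t t0; rewrite mulrDr.
Qed.

Lemma mellinZ c g s : mellin_integrable g (complex.Re s) ->
  mellin (fun t => c * g t) s = c%:C * mellin g s.
Proof.
move=> gi; rewrite !mellinE; apply: complex_ext => /=.
  rewrite mul0r subr0 -(Rintegral0yZ c (mellin_integrable_cos _ gi)).
  by apply: eq_Rintegral0y => t t0; rewrite mulrCA.
rewrite mul0r addr0 -(Rintegral0yZ c (mellin_integrable_sin _ gi)).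
by apply: eq_Rintegral0y => t t0; rewrite mulrCA.
Qed.

Lemma mellin0 s : mellin (fun=> 0) s = 0.
Proof.
rewrite mellinE; apply: complex_ext => /=.
  rewrite (@eq_Rintegral0y _ _ (cst 0)) ?Rintegral_cst ?mul0r // => t _.
  by rewrite mulr0.
rewrite (@eq_Rintegral0y _ _ (cst 0)) ?Rintegral_cst ?mul0r // => t _.
by rewrite mulr0.
Qed.

Lemma mellin_sum n (c : nat -> R) (g : nat -> R -> R) s :
  (forall i, (i < n)%N -> mellin_integrable (g i) (complex.Re s)) ->
  mellin (fun t => \sum_(i < n) c i * g i t) s = \sum_(i < n) (c i)%:C * mellin (g i) s.
Proof.
elim: n => [|n IH] H.
  rewrite big_ord0 (_ : (fun t => _) = (fun=> 0)); first exact: mellin0.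
  by apply/funext => t; rewrite big_ord0.
have H' i : (i < n)%N -> mellin_integrable (g i) (complex.Re s).
  by move=> ni; apply: H; rewrite ltnW.
rewrite (_ : (fun t => _) = (fun t => \sum_(i < n) c i * g i t + c n * g n t)); last first.
  by apply/funext => t; rewrite big_ord_recr.
rewrite mellinD; last 2 first.
- exact: mellin_integrable_sum.
- by apply: mellin_integrableZ; exact: H.
by rewrite IH // mellinZ ?big_ord_recr //; exact: H.
Qed.

Lemma mellin_shift p g s :
  mellin (fun t => t ^+ p * g t) s = mellin g (s + p%:R).
Proof.
rewrite /mellin /integral0y; congr Complex; apply: eq_Rintegral0y => t t0.
  by rewrite addrAC (cpowD t (s - 1) p%:R) cpow_nat // -mulrA rmorphM.
by rewrite addrAC (cpowD t (s - 1) p%:R) cpow_nat // -mulrA rmorphM.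
Qed.

Lemma mellin_integrable_shift p g a : mellin_integrable g (a + p%:R) ->
  mellin_integrable (fun t => t ^+ p * g t) a.
Proof.
move=> [mg gi]; split.
  by apply: measurable_funM => //; exact: exprn_measurable.
apply: eq_integrable0y gi => t t0.
rewrite addrAC (rpowD (a - 1) p%:R) rpow_nat // normrM (ger0_norm (exprn_ge0 _ (ltW t0))).
by rewrite mulrA.
Qed.

Lemma mellin_integrable_le f g a : measurable_fun D f ->
  (forall t, 0 < t -> `|f t| <= g t) -> mellin_integrable g a -> mellin_integrable f a.
Proof.
move=> mf fg [mg gi]; split=> //; apply: (integrable0y_le _ gi).
  apply: measurable_funM; first exact: measurable_rpow.
  exact: measurableT_comp.
move=> t t0; rewrite normrM normr_id gtr0_norm ?rpow_gt0 // ler_pM2l ?rpow_gt0 //.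
by apply: le_trans (fg t t0) _; exact: ler_norm.
Qed.

Lemma mellin_cvg (f_ : nat -> R -> R) f g s :
  (forall n, measurable_fun D (f_ n)) ->
  (forall t, 0 < t -> f_ n t @[n --> \oo] --> f t) ->
  mellin_integrable g (complex.Re s) ->
  (forall n t, 0 < t -> `|f_ n t| <= g t) ->
  complex.Re (mellin (f_ n) s) @[n --> \oo] --> complex.Re (mellin f s) /\
  complex.Im (mellin (f_ n) s) @[n --> \oo] --> complex.Im (mellin f s).
Proof.
move=> mf cf [mg gi] fg.
set a := complex.Re s in gi; set b := complex.Im s.
have mc : measurable_fun D (rpow_cos (a - 1) b).
  by apply: continuous_measurable0y => t; exact: continuous_rpow_cos.
have ms : measurable_fun D (rpow_sin (a - 1) b).
  by apply: continuous_measurable0y => t; exact: continuous_rpow_sin.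
have key (k : R -> R) : measurable_fun D k -> (forall t, `|k t| <= rpow (a - 1) t) ->
    Rintegral mu D (fun t => k t * f_ n t) @[n --> \oo] --> Rintegral mu D (fun t => k t * f t).
  move=> mk kt.
  have h1 n : measurable_fun D (fun t => k t * f_ n t) by exact: measurable_funM.
  have h2 t : 0 < t -> k t * f_ n t @[n --> \oo] --> k t * f t.
    by move=> t0; apply: cvgMl_tmp; exact: cf.
  have h3 n t : 0 < t -> `|k t * f_ n t| <= rpow (a - 1) t * `|g t|.
    move=> t0; rewrite normrM ler_pM //.
    by apply: le_trans (fg n t t0) _; exact: ler_norm.
  exact: (proj2 (dominated_cvg0y h1 h2 gi h3)).
split.
  rewrite (_ : (fun n => _) = fun n => Rintegral mu D (fun t => rpow_cos (a - 1) b t * f_ n t)).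
    by rewrite mellinE /=; apply: key => // t; exact: norm_rpow_cos_le.
  by apply/funext => n; rewrite mellinE.
rewrite (_ : (fun n => _) = fun n => Rintegral mu D (fun t => rpow_sin (a - 1) b t * f_ n t)).
  by rewrite mellinE /=; apply: key => // t; exact: norm_rpow_sin_le.
by apply/funext => n; rewrite mellinE.
Qed.

Lemma GammaE s : Gamma s = gamma_cos (complex.Re s) (complex.Im s) +i*
  gamma_sin (complex.Re s) (complex.Im s).
Proof. exact: mellinE. Qed.

Lemma Gamma_succ s : 1 < complex.Re s -> Gamma (s + 1) = s * Gamma s.
Proof.
case: s => a b /= a1; rewrite !GammaE /= addr0 gamma_cos_succ // gamma_sin_succ //.
Qed.

Lemma ReD (x y : C) : complex.Re (x + y) = complex.Re x + complex.Re y.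
Proof. by case: x; case: y. Qed.

Lemma ImD (x y : C) : complex.Im (x + y) = complex.Im x + complex.Im y.
Proof. by case: x; case: y. Qed.

Lemma Re_nat n : complex.Re (n%:R : C) = n%:R.
Proof. by rewrite -(rmorph_nat (real_complex R)). Qed.

Lemma Im_nat n : complex.Im (n%:R : C) = 0.
Proof. by rewrite -(rmorph_nat (real_complex R)). Qed.

(** Origin of [risbin] in the theorem; the factor [n!] later cancels the denominators of the
    monomials. *)
Lemma Gamma_add_nat s n : 1 < complex.Re s ->
  Gamma (s + n%:R) = n`!%:R * risbin s n * Gamma s.
Proof.
move=> s1; have fn0 : n`!%:R != 0 :> C by rewrite pnatr_eq0 -lt0n fact_gt0.
rewrite /risbin [n`!%:R * _]mulrC divfK //.
elim: n {fn0} => [|n IH]; first by rewrite addr0 big_ord0 mul1r.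
rewrite -natr1 addrA Gamma_succ; last first.
  by rewrite ReD Re_nat; have := ler0n R n; lra.
by rewrite IH big_ord_recr /= mulrA; congr (_ * _); rewrite mulrC.
Qed.

Lemma Gamma_neq0 s : 1 < complex.Re s -> Gamma s != 0.
Proof.
move=> s1; pose a := complex.Re s; pose b := complex.Im s.
(* Adding [n] leaves the imaginary part [b] unchanged and moves the real part past both thresholds
   of [gamma_phase_gt0]. *)
have [n [h1 h2]] : exists n, b ^+ 2 <= n%:R /\ 2 <= n%:R :> R.
  near \oo => n; exists n; split; near: n; exact: nbhs_infty_ger.
have h3 : 2 < a + n%:R by rewrite /a; lra.
have h4 : b ^+ 2 < 2 * (a + n%:R - 1) by rewrite /a; lra.
have := gamma_phase_gt0 h3 h4.
have := Gamma_add_nat n s1; rewrite GammaE ReD ImD Re_nat Im_nat addr0 -/a -/b => e.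
apply: contraTneq => G0; move: e; rewrite G0 mulr0 => -[-> ->].
by rewrite !mulr0 addr0 ltxx.
Unshelve. all: by end_near. Qed.

Lemma mellin_integrable_exp_scale c a : 1 <= c -> 0 < a ->
  mellin_integrable (fun t => expR (- (c * t))) a.
Proof.
move=> c1 a0; apply: (mellin_integrable_le _ _ (mellin_integrable_expRN a0)).
  apply: continuous_measurable0y => t t0.
  exact: is_derive_continuous (is_derive_comp (g := fun u => c * u)
    (is_derive_expN (c * t)) (is_derive_scale c (is_derive_var t))).
move=> t t0; rewrite ger0_norm ?expR_ge0 // ler_expR lerN2.
by rewrite ler_peMl // ltW.
Qed.

(** Meant for the two real kernels of [t^(s-1)]: scaling [t] by [c] multiplies the complex kernel by
    [c^(s-1)], so each real kernel becomes a combination of both, with coefficients [p] and [q]. *)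
Lemma Rintegral0y_exp_scale (k K L : R -> R) (p q c : R) : 0 < c ->
  (forall t, 0 < t -> {for t, continuous k}) ->
  integrable0y (fun t => k t * expR (- t)) ->
  integrable0y (fun t => K t * expR (- (c * t))) ->
  integrable0y (fun t => L t * expR (- (c * t))) ->
  (forall t, 0 < t -> c * k (c * t) = p * K t + q * L t) ->
  Rintegral mu D (fun t => k t * expR (- t)) =
  p * Rintegral mu D (fun t => K t * expR (- (c * t))) +
  q * Rintegral mu D (fun t => L t * expR (- (c * t))).
Proof.
move=> c0 ck ik iK iL e.
rewrite -(Rintegral0yZ p iK) -(Rintegral0yZ q iL).
have j1 := integrable0yZ p iK; have j2 := integrable0yZ q iL.
rewrite -(Rintegral0yD j1 j2).
have e' t : 0 < t -> p * (K t * expR (- (c * t))) + q * (L t * expR (- (c * t))) =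
    c * (k (c * t) * expR (- (c * t))).
  by move=> t0; rewrite [RHS]mulrA e //; ring.
rewrite (eq_Rintegral0y e').
rewrite (@Rintegral0y_scale _ (fun t => k t * expR (- t))) //.
  move=> t t0; apply: continuous_mul; [exact: ck|exact: continuous_expRN].
exact: eq_integrable0y e' (integrable0yD j1 j2).
Qed.

Lemma mellin_exp_scale c s : 1 <= c -> 0 < complex.Re s ->
  mellin (fun t => expR (- (c * t))) s = Gamma s / cpow c s.
Proof.
move=> c1 s0; have c0 : 0 < c by lra.
apply: (mulIf (cpow_neq0 c s)); rewrite divfK ?cpow_neq0 //.
have ie := mellin_integrable_exp_scale c1 s0.
rewrite GammaE mellinE; set a := complex.Re s in s0 ie *; set b := complex.Im s.
have ic := mellin_integrable_cos b ie.
have isn := mellin_integrable_sin b ie.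
have i1 := mellin_integrable_cos b (mellin_integrable_expRN s0).
have i2 := mellin_integrable_sin b (mellin_integrable_expRN s0).
have rc t : 0 < t -> rpow (a - 1) (c * t) = rpow a c / c * rpow (a - 1) t.
  by move=> t0; rewrite -rpowB1 // /rpow lnM ?posrE // mulrDr expRD.
have eC t : 0 < t -> c * rpow_cos (a - 1) b (c * t) =
    rpow a c * cos (b * ln c) * rpow_cos (a - 1) b t +
    - (rpow a c * sin (b * ln c)) * rpow_sin (a - 1) b t.
  move=> t0; rewrite /rpow_cos /rpow_sin rc // lnM ?posrE // mulrDr cosD.
  by field; rewrite gt_eqF.
have eS t : 0 < t -> c * rpow_sin (a - 1) b (c * t) =
    rpow a c * sin (b * ln c) * rpow_cos (a - 1) b t +
    rpow a c * cos (b * ln c) * rpow_sin (a - 1) b t.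
  move=> t0; rewrite /rpow_cos /rpow_sin rc // lnM ?posrE // mulrDr sinD.
  by field; rewrite gt_eqF.
have GC : gamma_cos a b = _ :=
  Rintegral0y_exp_scale c0 (@continuous_rpow_cos _ (a - 1) b) i1 ic isn eC.
have GS : gamma_sin a b = _ :=
  Rintegral0y_exp_scale c0 (@continuous_rpow_sin _ (a - 1) b) i2 ic isn eS.
rewrite GC GS.
rewrite /cpow -/a -/b -/(rpow a c).
by apply: complex_ext => /=; ring.
Qed.

End Mellin.

(** * The sums A and T as power series *)

Section Sums.
Local Open Scope classical_set_scope.
Local Open Scope complex_scope.
Local Open Scope ring_scope.
Variable R : realType.
Local Notation C := (R[i]).
Implicit Types (t z a : R) (s : C) (k l : seq nat).

Section FieldMorphism.
Variables (K : fieldType) (phi : {rmorphism R -> K}).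

(** The disjunction excludes a false case: for the empty index the left side is [1], but the right
    side is an empty sum when [q = 0]. The morphism [phi] is the identity for [A] and the inclusion
    into the complex numbers for [T]. *)
Let nested_zeta l (h : nat -> nat -> K) q : (l != [::]) || (0 < q)%N ->
  (forall i n, (i < size l)%N -> h i n = phi (n%:R ^+ nth 0%N (rev l) i)^-1) ->
  2 ^+ size l * nested_sum h (size l) q = phi (\sum_(m < q) zeta_coef R l m).
Proof.
elim: l h q => [|p l IH] h q.
  case: q => // q _ _; rewrite /= mulr1 big_ord_recl big1 ?addr0 ?rmorph1 //.
move=> _ H; rewrite /= rmorph_sum mulr_sumr big_mkcond /=.
apply: eq_bigr => x _; case: ifP => [xl|_]; last by rewrite !mul0r rmorph0.
have sl i : (i < size l)%N -> nth 0%N (rev (p :: l)) i = nth 0%N (rev l) i.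
  by move=> il; rewrite rev_cons nth_rcons size_rev il.
rewrite H // rev_cons nth_rcons size_rev ltnn eqxx exprS mul1r.
rewrite [2 * _ * _](_ : _ = 2 * phi (x%:R ^+ p)^-1 *
   (2 ^+ size l * nested_sum h (size l) x)); last by ring.
rewrite IH; last 2 first.
- case: (l) xl => //= xl; by case: (nat_of_ord x) xl.
- by move=> i n il; rewrite H ?sl // ltnW.
by rewrite !rmorphM rmorph_nat.
Qed.

(** The outermost variable has its own weight [g], since it carries [z^n / n^p] in [A] and [n^(-s)]
    in [T]; the exponent [0] reserves its place in [zeta_coef]. *)
Lemma nested_sum_zeta l (h : nat -> nat -> K) (g : nat -> K) N :
  (forall i n, (i < size l)%N -> h i n = phi (n%:R ^+ nth 0%N (rev l) i)^-1) ->
  (forall n, h (size l) n = g n) ->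
  2 ^+ (size l).+1 * nested_sum h (size l).+1 N =
    \sum_(x < N) phi (zeta_coef R (0%N :: l) x) * g x.
Proof.
move=> H Hg; rewrite /= mulr_sumr big_mkcond /=.
apply: eq_bigr => x _; case: ifP => [xl|_]; last by rewrite !mul0r rmorph0 mul0r.
rewrite Hg exprS mul1r expr0 divr1.
rewrite [2 * _ * _](_ : _ = 2 * (2 ^+ size l * nested_sum h (size l) x) * g x); last by ring.
rewrite nested_zeta //; first by rewrite rmorphM rmorph_nat.
by case: (l) xl => //= xl; case: (nat_of_ord x) xl.
Qed.

End FieldMorphism.

Lemma A_zeta_series p l z : `|z| < 1 -> A (rev (p :: l)) z = zeta_series (p :: l) z.
Proof.
move=> z1; set k := rev (p :: l).
have sk : size k = (size l).+1 by rewrite size_rev.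
pose h i n : R := (if (i < size l)%N then 1 else z ^+ n) * (n%:R ^+ nth 0%N k i)^-1.
rewrite /A sk.
rewrite [X in limn X](_ : _ = fun N => (2 ^+ (size l).+1)^-1 * pseries (zeta_coef R (p :: l)) z N).
  have cz : (2 ^+ (size l).+1)^-1 * pseries (zeta_coef R (p :: l)) z N @[N --> \oo] -->
      (2 ^+ (size l).+1)^-1 * zeta_series (p :: l) z.
    by apply: cvgMl_tmp; exact: zeta_series_cvg.
  by rewrite (cvg_lim _ cz) // mulVKf // expf_neq0.
apply/funext => N; apply: (mulfI (_ : 2 ^+ (size l).+1 != 0 :> R)); first by rewrite expf_neq0.
rewrite mulVKf ?expf_neq0 //.
transitivity (2 ^+ (size l).+1 * nested_sum h (size l).+1 N).
  congr (_ * _); rewrite -admissible_sum; apply: eq_bigr => m _.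
  rewrite big_split /= prodfV; congr (_ / _).
  rewrite big_ord_recr /= ltnn big1 ?mul1r => [|i _]; last by rewrite ltn_ord.
  congr (_ ^+ _); rewrite (tnth_nth (tnth m ord_max)) -(nth_map _ 0%N) ?size_tuple //.
  by rewrite -nth_last size_map size_tuple.
rewrite (@nested_sum_zeta _ idfun l h (fun n => z ^+ n / n%:R ^+ p)).
- rewrite /pseries /series /= big_mkord; apply: eq_bigr => x _ /=.
  by rewrite expr0 divr1; ring.
- by move=> i n il; rewrite /h il mul1r /k rev_cons nth_rcons size_rev il.
- by move=> n; rewrite /h ltnn /k rev_cons nth_rcons size_rev ltnn eqxx.
Qed.

Lemma cvg_complex (u : nat -> C) (c : C) :
  complex.Re (u n) @[n --> \oo] --> complex.Re c ->
  complex.Im (u n) @[n --> \oo] --> complex.Im c ->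
  (u n : C^o) @[n --> \oo] --> (c : C^o).
Proof.
move=> /cvgrPdist_lt re /cvgrPdist_lt im.
apply/cvgrPdist_lt => e e0.
have [e' e'0 ee] : exists2 e' : R, 0 < e' & e = e'%:C.
  move: e0; rewrite ltcE /= => /andP[/eqP h1 h2]; exists (complex.Re e) => //.
  by case: e h1 h2 => x y /= ->.
have e20 : 0 < e' / 2 by rewrite divr_gt0.
near=> n.
have h1 : `|complex.Re c - complex.Re (u n)| < e' / 2 by near: n; exact: re.
have h2 : `|complex.Im c - complex.Im (u n)| < e' / 2 by near: n; exact: im.
rewrite ee normc_def ltcR.
rewrite -[X in _ < X]gtr0_norm // -sqrtr_sqr ltr_sqrt ?exprn_gt0 //.
have -> : complex.Re (c - u n) = complex.Re c - complex.Re (u n) by case: (c); case: (u n).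
have -> : complex.Im (c - u n) = complex.Im c - complex.Im (u n) by case: (c); case: (u n).
move: h1 h2; rewrite !ltr_norml => /andP[h1 h2] /andP[h3 h4].
set X := complex.Re c - _ in h1 h2 *; set Y := complex.Im c - _ in h3 h4 *.
by clearbody X Y; nra.
Unshelve. all: by end_near. Qed.

(** For [l = [:: p.+1]] this is [U_p / sinh], already written as a power series in [e^(-t)]. *)
Definition zeta_exp l t : R := zeta_series (0%N :: l) (expR (- t)).

Lemma expRN_itv t : 0 < t -> 0 <= expR (- t) < 1.
Proof. by move=> t0; rewrite expR_ge0 -[X in X < _]ger0_norm ?expR_ge0 // expRN_lt1. Qed.

(** Convergence enters as a premise: it is supplied by the integrals below and then determines the
    [limn] inside [T]. *)
Lemma T_eq_lim l s (v : C) :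
  (\sum_(x < N) (zeta_coef R (0%N :: l) x)%:C / cpow x%:R s : C^o) @[N --> \oo] --> (v : C^o) ->
  T (rev l) s = v.
Proof.
move=> cv; set k := rev l; have sk : size k = size l by rewrite size_rev.
have n0 : 2 ^+ (size l).+1 != 0 :> C by rewrite expf_neq0 // pnatr_eq0.
pose h i n : C := if (i < size l)%N then (n%:R ^+ nth 0%N k i)^-1 else (cpow n%:R s)^-1.
rewrite /T sk; set u := (X in limn X).
have uE : u = fun N => (2 ^+ (size l).+1)^-1 *
    \sum_(x < N) (zeta_coef R (0%N :: l) x)%:C / cpow x%:R s.
  apply/funext => N; apply: (mulfI n0); rewrite mulrA mulfV // mul1r.
  transitivity (2 ^+ (size l).+1 * nested_sum h (size l).+1 N).
    congr (_ * _); rewrite -admissible_sum; apply: eq_bigr => m _.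
    rewrite invfM -prodfV big_ord_recr /= {2}/h ltnn; congr (_ * _).
    by apply: eq_bigr => i _; rewrite /h /= ltn_ord.
  rewrite (@nested_sum_zeta _ (real_complex R) l h (fun n => (cpow n%:R s)^-1)) //.
  - by move=> i n il; rewrite /h il fmorphV rmorphXn rmorph_nat.
  - by move=> n; rewrite /h ltnn.
have cu : (u N : C^o) @[N --> \oo] --> ((2 ^+ (size l).+1)^-1 * v : C^o).
  by rewrite uE; exact: cvgMl_tmp.
by rewrite (cvg_lim (@norm_hausdorff _ _) cu) mulrA mulfV // mul1r.
Qed.

Lemma T_nat p : T [::] (p.+2%:R : C) = (zeta_series [:: p.+2] (1 : R))%:C.
Proof.
apply: (@T_eq_lim [::]).
have ce x : (zeta_coef R [:: 0%N] x)%:C / cpow x%:R (p.+2%:R : C) =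
    (zeta_coef R [:: p.+2] x)%:C.
  case: x => [|x]; first by rewrite !zeta_coef_cons0 rmorph0 mul0r.
  rewrite cpow_nat // -fmorphV -rmorphM; congr _%:C.
  by rewrite !zeta_coef1E; case: ifP => _; rewrite ?mul0r // expr0 divr1.
have e N : \sum_(x < N) (zeta_coef R [:: 0%N] x)%:C / cpow x%:R (p.+2%:R : C) =
    (pseries (zeta_coef R [:: p.+2]) 1 N)%:C.
  rewrite /pseries /series /= big_mkord rmorph_sum; apply: eq_bigr => x _ /=.
  by rewrite -!/(zeta_coef R [:: _] x) ce expr1n mulr1.
apply: cvg_complex; (under eq_fun do rewrite e /=); last exact: cvg_cst.
exact: zeta_series1_cvg.
Qed.

(** The truncations are integrated term by term; their coefficients are nonnegative, so the full
    series dominates them. Dividing by [Gamma s], which is non-zero, yields the convergence of the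
    sums in [T] as well. *)
Lemma Gamma_mul_T l s : 1 < complex.Re s ->
  mellin_integrable (zeta_exp l) (complex.Re s) ->
  mellin (zeta_exp l) s = Gamma s * T (rev l) s.
Proof.
move=> s1 gi; have G0 := Gamma_neq0 s1.
have s0 : 0 < complex.Re s by apply: lt_trans s1.
pose c i := zeta_coef R (0%N :: l) i.+1.
pose g i (t : R) := expR (- (i.+1%:R * t)).
pose P N t := \sum_(i < N) c i * g i t.
have ig i N : (i < N)%N -> mellin_integrable (g i) (complex.Re s).
  by move=> _; apply: mellin_integrable_exp_scale => //; rewrite ler1n.
have PE N t : P N t = pseries (zeta_coef R (0%N :: l)) (expR (- t)) N.+1.
  rewrite /pseries /series /= big_nat_recl // -/(zeta_coef R (0%N :: l) 0) zeta_coef_cons0.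
  rewrite mul0r add0r big_mkord; apply: eq_bigr => i _.
  by rewrite /c /g /= -expRM_natl mulrN.
have mP N : mellin (P N) s = \sum_(i < N) (c i)%:C * (Gamma s / cpow i.+1%:R s).
  rewrite /P mellin_sum; last by move=> i; exact: ig.
  by apply: eq_bigr => i _; rewrite mellin_exp_scale // ler1n.
have [cRe cIm] : complex.Re (mellin (P N) s) @[N --> \oo] --> complex.Re (mellin (zeta_exp l) s) /\
  complex.Im (mellin (P N) s) @[N --> \oo] --> complex.Im (mellin (zeta_exp l) s).
  apply: (@mellin_cvg _ P (zeta_exp l) (zeta_exp l)) => //.
  - by move=> n; case: (@mellin_integrable_sum _ n c g _ (fun i => @ig i n)).
  - move=> t t0.
    have -> : P^~ t = [sequence pseries (zeta_coef R (0%N :: l)) (expR (- t)) N.+1]_N.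
      by apply/funext => N; exact: PE.
    by rewrite cvg_shiftS; apply: zeta_series_cvg; exact: expRN_lt1.
  - move=> n t t0; rewrite PE ger0_norm.
      by apply: pseries_zeta_le; exact: expRN_itv.
    by apply: sumr_ge0 => i _; rewrite mulr_ge0 ?zeta_coef_ge0 // exprn_ge0 // expR_ge0.
have cP := cvg_complex cRe cIm.
rewrite (@T_eq_lim l s ((Gamma s)^-1 * mellin (zeta_exp l) s)); first by rewrite mulVKf.
(* The coefficient at [n = 0] vanishes, and the exponentials in [P] start at [n = 1]. *)
rewrite -cvg_shiftS (_ : [sequence _]_N = fun N => (Gamma s)^-1 * mellin (P N) s).
  exact: cvgMl_tmp.
apply/funext => N.
rewrite -[LHS]/(\sum_(x < N.+1) (zeta_coef R (0%N :: l) x)%:C / cpow x%:R s) mP mulr_sumr.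
rewrite big_ord_recl (zeta_coef_cons0 R 0 l : zeta_coef R (0%N :: l) ord0 = 0).
rewrite rmorph0 mul0r add0r; apply: eq_bigr => i _.
rewrite /c -[nat_of_ord (lift ord0 i)]/(i.+1).
by field; rewrite G0 cpow_neq0.
Qed.

End Sums.

(** * Termwise Mellin transform *)

Section Integrability.
Local Open Scope classical_set_scope.
Local Open Scope complex_scope.
Local Open Scope ring_scope.
Variable R : realType.
Implicit Types (t a : R).
Local Notation D := (`]0, +oo[%classic : set R).

Lemma measurable_zeta_exp l : measurable_fun D (@zeta_exp R l).
Proof.
apply: continuous_measurable0y => t t0.
have ct := @subexponential_zeta_coef R (0%N :: l).
exact: is_derive_continuous (is_derive_comp (g := fun u => expR (- u))
  (is_derive_subexponential ct (expRN_lt1 t0)) (is_derive_expN t)).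
Qed.

Lemma zeta_expE l t : 0 < t -> zeta_exp l t = zeta_series l (expR (- t)) / sinh t.
Proof. exact: zeta_series_0_expN. Qed.

Lemma zeta_exp_ge0 l t : 0 < t -> 0 <= zeta_exp l t.
Proof. by move=> t0; apply: zeta_series_ge0; exact: expRN_itv. Qed.

(** Equivalent to [e^(2t) >= 1 + 2t]. The first term matches the pole at [0], the second the decay
    at infinity; times a power of [t], both are Gamma integrands. *)
Lemma inv_sinh_le t : 0 < t -> (sinh t)^-1 <= expR (- t) / t + 2 * expR (- t).
Proof.
move=> t0; rewrite sinhE expRN; have e1 := pexpR_gt1 t0.
have e2 : 1 + t * 2 <= expR t ^+ 2 by rewrite -expRM_natr; exact: expR_ge1Dx.
set e := expR t in e1 e2 *.
have d0 : 0 < e ^+ 2 - 1 by nra.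
have e0 : 0 < e by lra.
have -> : e^-1 / t + 2 / e = (1 + t * 2) / (t * e) by field; rewrite !gt_eqF.
have -> : ((e ^+ 2 - 1) / (2 * e))^-1 = 2 * e / (e ^+ 2 - 1).
  by field; rewrite !gt_eqF.
rewrite ler_pdivrMr // mulrAC ler_pdivlMr ?mulr_gt0 //.
rewrite -subr_ge0 (_ : _ - _ = e ^+ 2 - 1 - t * 2); first by lra.
by ring.
Qed.

Lemma mellin_integrable_zeta_exp0 a : 1 < a -> mellin_integrable (@zeta_exp R [::]) a.
Proof.
move=> a1; have a0 : 0 < a by lra.
have a10 : 0 < a - 1 by lra.
have mz := @measurable_zeta_exp [::].
have mr := @measurable_rpow R (a - 1).
split=> //; apply: (integrable0y_le _ (integrable0yD (integrable_rpow_expRN a10)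
  (integrable0yZ 2 (integrable_rpow_expRN a0)))).
  by apply: measurable_funM => //; exact: measurableT_comp.
move=> t t0; rewrite normrM normr_id gtr0_norm ?rpow_gt0 // ger0_norm ?zeta_exp_ge0 //.
rewrite zeta_expE // zeta_series_nil mul1r [rpow (a - 1 - 1) t]rpowB1 //.
have := inv_sinh_le t0; rewrite -(ler_pM2l (rpow_gt0 (a - 1) t)) => h.
by apply: le_trans h _; rewrite le_eqVlt; apply/orP; left; apply/eqP; ring.
Qed.

(** For [l >= 1] the series is bounded by its value at [1]. For [l = 0] it is bounded by
    [1 / sinh t <= 1 / t], which costs one power of [t] and raises the threshold to [2]. *)
Lemma mellin_integrable_zeta_exp1 l a : (if l is 0%N then 2 else 1) < a ->
  mellin_integrable (@zeta_exp R [:: l.+1]) a.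
Proof.
move=> la; have mz := @measurable_zeta_exp [:: l.+1].
case: l la mz => [|l] la mz; last first.
  apply: (mellin_integrable_le mz _ (mellin_integrableZ (zeta_series [:: l.+2] 1)
    (mellin_integrable_zeta_exp0 la))) => t t0.
  rewrite ger0_norm ?zeta_exp_ge0 // !zeta_expE // zeta_series_nil mul1r.
  by rewrite ler_pM2r ?invr_gt0 ?sinh_gt0 // zeta_series_le1 // expRN_itv.
have a1 : 1 < a - 1 by lra.
have mr := @measurable_rpow R (a - 1).
split=> //; apply: (integrable0y_le _ (proj2 (mellin_integrable_zeta_exp0 a1))).
  by apply: measurable_funM => //; exact: measurableT_comp.
move=> t t0; rewrite normrM normr_id gtr0_norm ?rpow_gt0 //.
rewrite !ger0_norm ?zeta_exp_ge0 // !zeta_expE // zeta_series_nil mul1r.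
rewrite [rpow (a - 1 - 1) t]rpowB1 // -mulrA ler_pM2l ?rpow_gt0 //.
rewrite ler_pM2r ?invr_gt0 ?sinh_gt0 //.
apply: le_trans (zeta_series1_le 1 (expRN_itv t0)) _.
rewrite -/(zeta_exp [::] t) zeta_expE // zeta_series_nil mul1r.
by rewrite lef_pV2 ?posrE ?sinh_gt0 // sinh_ge // ltW.
Qed.

End Integrability.

Section Psi.
Local Open Scope complex_scope.
Local Open Scope ring_scope.
Variable R : realType.
Local Notation C := (R[i]).

(** Here [j] is one less than in the theorem, and [m] stands for [r - j] there. *)
Lemma psi_expansion (j m : nat) (s : C) : 1 < complex.Re s ->
  psi (nseq j 1%N ++ 2%N :: nseq m 1%N) s =
  \sum_(i < m.+1) (-1) ^+ i * 'C(i + j.+1, i)%:R * risbin s (m - i)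
    * T [::] ((i + j.+1).+1%:R : C) * T [::] (s + (m - i)%:R)
  + (-1) ^+ m.+1 * \sum_(a < j.+2) 'C(a + m, m)%:R * risbin s (j.+1 - a)
    * T [:: (a + m).+1] (s + (j.+1 - a)%:R).
Proof.
move=> s1; have G0 := Gamma_neq0 s1.
have Re1 p : 1 < complex.Re (s + p%:R) by rewrite ReD Re_nat; have := ler0n R p; lra.
pose cP i : R := (-1) ^+ i * 'C(i + j.+1, i)%:R * zeta_series [:: (i + j.+1).+1] 1
  / (m - i)`!%:R.
pose gP i (t : R) := t ^+ (m - i) * zeta_exp [::] t.
pose cQ a : R := (-1) ^+ m.+1 * 'C(a + m, m)%:R / (j.+1 - a)`!%:R.
pose gQ a (t : R) := t ^+ (j.+1 - a) * zeta_exp [:: (a + m).+1] t.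
have izP i : mellin_integrable (@zeta_exp R [::]) (complex.Re (s + (m - i)%:R)).
  exact: mellin_integrable_zeta_exp0.
have izQ a : (a < j.+2)%N ->
    mellin_integrable (@zeta_exp R [:: (a + m).+1]) (complex.Re (s + (j.+1 - a)%:R)).
  (* In the logarithmic case [a + m = 0] the factor [t^(j+1)] brings the real part above [2]. *)
  move=> aj; apply: mellin_integrable_zeta_exp1; case e: (a + m)%N => [|b]; last exact: Re1.
  have -> : a = 0%N by case: (a) e.
  by rewrite subn0 ReD Re_nat -natr1; have := ler0n R j; lra.
have iP i : (i < m.+1)%N -> mellin_integrable (gP i) (complex.Re s).
  by move=> _; apply: mellin_integrable_shift; have := izP i; rewrite ReD Re_nat.
have iQ a : (a < j.+2)%N -> mellin_integrable (gQ a) (complex.Re s).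
  by move=> /izQ; rewrite ReD Re_nat => h; exact: mellin_integrable_shift.
have AE t : 0 < t -> A (nseq j 1%N ++ 2%N :: nseq m 1%N) (tanh (t / 2)) / sinh t =
    \sum_(i < m.+1) cP i * gP i t + \sum_(a < j.+2) cQ a * gQ a t.
  move=> t0.
  have -> : A (nseq j 1%N ++ 2%N :: nseq m 1%N) (tanh (t / 2)) =
      zeta_series (nseq m 1%N ++ 2%N :: nseq j 1%N) (tanh (t / 2)).
    have -> : nseq j 1%N ++ 2%N :: nseq m 1%N = rev (nseq m 1%N ++ 2%N :: nseq j 1%N).
      by rewrite rev_cat rev_cons !rev_nseq cat_rcons.
    (* The case split only exposes the head of the index, which [A_zeta_series] asks for. *)
    by case: (m) => [|m']; rewrite A_zeta_series ?tanh_half_lt1.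
  rewrite zeta_tanh_expansion // mulrDl; congr (_ + _).
    rewrite mulr_suml; apply: eq_bigr => i _.
    by rewrite /cP /gP zeta_expE // zeta_series_nil /monomial; ring.
  rewrite mulr_sumr mulr_suml; apply: eq_bigr => a _.
  by rewrite /cQ /gQ zeta_expE // /monomial; ring.
rewrite /psi -/(mellin (fun t => A (nseq j 1%N ++ 2%N :: nseq m 1%N) (tanh (t / 2)) / sinh t) s).
rewrite (eq_mellin s AE) mellinD; last 2 first.
- exact: mellin_integrable_sum.
- exact: mellin_integrable_sum.
rewrite (mellin_sum cP iP) (mellin_sum cQ iQ) mulrDr; congr (_ + _).
  rewrite mulr_sumr; apply: eq_bigr => i _.
  rewrite mellin_shift (Gamma_mul_T (Re1 _) (izP i)) Gamma_add_nat // addnS T_nat.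
  rewrite /cP !rmorphM fmorphV rmorphXn rmorphN1 !rmorph_nat addnS.
  by field; rewrite G0 pnatr_eq0 -lt0n fact_gt0.
rewrite !mulr_sumr; apply: eq_bigr => a _.
rewrite mellin_shift (Gamma_mul_T (Re1 _) (izQ a (ltn_ord a))) Gamma_add_nat //.
rewrite /cQ !rmorphM fmorphV rmorphXn rmorphN1 !rmorph_nat.
by field; rewrite G0 pnatr_eq0 -lt0n fact_gt0.
Qed.

End Psi.

Local Open Scope complex_scope.
Local Open Scope ring_scope.

Theorem theorem2p15 (R : realType) (r j : nat) (s : R[i]) :
  (0 < j)%N -> (j <= r)%N -> 1 < complex.Re s ->
  psi (nseq j.-1 1%N ++ 2%N :: nseq (r - j) 1%N) s =
    \sum_(0 <= i < (r - j).+1)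
      (-1) ^+ i * 'C(i + j, i)%:R * risbin s (r - i - j)
      * T [::] ((i + j + 1)%:R : R[i]) * T [::] (s + (r - i - j)%:R)
    + (-1) ^ (r%:Z - j%:Z - 1) *
      \sum_(r - j <= l < r.+1)
        'C(l, r - j)%:R * risbin s (r - l)
        * T [:: l.+1] (s + (r - l)%:R).
Proof.
case: j => // j _ jr s1; pose m := (r - j.+1)%N.
have rE : r = (m + j.+1)%N by rewrite subnK.
rewrite psi_expansion // -/m; congr (_ + _).
  rewrite big_mkord; apply: eq_bigr => i _.
  have -> : (r - i - j.+1 = m - i)%N by rewrite subnAC.
  by rewrite addn1.
(* The exponent is an integer, equal to [-1] when [r = j] in the theorem; [m - 1] and [m + 1] have
   the same parity. *)
have sgn : (-1) ^ (r%:Z - j.+1%:Z - 1) = (-1) ^+ m.+1 :> R[i].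
  rewrite subzn // expfzDr ?oppr_eq0 ?oner_eq0 // exprSr; congr (_ * _).
  by rewrite -invr_expz expr1z invrN1.
rewrite sgn; congr (_ * _).
(* Substitution [l = a + m]. *)
rewrite -[X in \sum_(X <= _ < _) _]add0n big_addn (_ : (r.+1 - m = j.+2)%N); last by rewrite rE -addnS addKn.
rewrite big_mkord; apply: eq_bigr => a _.
by have -> : (r - (a + m) = j.+1 - a)%N by rewrite rE [(a + m)%N]addnC subnDl.
Qed.
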